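(* Let $G=(V,E)$ be an infinite, connected, locally finite simple graph satisfying: (i) $G$ is vertex-transitive; (ii) if $S^1,S^2$ are independent simple random walks on $G$ started at the same vertex, then almost surely the set of vertices visited by both walks is finite (they intersect only finitely often); (iii) $\mu$-a.s. each component of the wired spanning forest of $G$ has one end; (iv) every bounded harmonic function on $G$ is constant. Then there exists a probability measure $\nu$ on $\Omega_G=\prod_{x\in V}\{0,\dots,\deg_G(x)-1\}$ such that $\nu_{G_n}\Rightarrow\nu$ for every exhaustion $V_1\subset V_2\subset\cdots$ of $V$ (the limit being independent of the exhaustion).
   Context: An exhaustion of $V$ is a sequence of finite sets $V_1\subset V_2\subset\cdots$ with $\bigcup_nV_n=V$. The wired graph $G_n$ is obtained from $G$ by identifying all vertices of $V\setminus V_n$ to a single sink vertex $s$ and removing loops at $s$. $\mu_{G_n}$ is the uniform measure on spanning trees of $G_n$; the WSF measure $\mu$ is the weak limit of $\mu_{G_n}$ (exists, independent of the exhaustion, concentrated on spanning forests with all components infinite). A tree has one end if any two infinite self-avoiding paths in it share infinitely many vertices. $h:V\to\mathbb R$ is harmonic if $h(x)=\deg_G(x)^{-1}\sum_{y\sim x}h(y)$ for all $x$. $\nu_{G_n}$ is the stationary distribution of the Abelian sandpile Markov chain on $G_n$ with sink $s$ (uniform on recurrent configurations). Weak convergence means convergence of the joint law of $(\eta_x)_{x\in A}$ for every finite $A\subset V$. *)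

(* Defs.v *)
From HB Require Import structures.
From mathcomp Require Import all_boot all_order all_algebra finmap.
From mathcomp Require Import all_classical all_reals all_analysis.
Set Implicit Arguments. Unset Strict Implicit. Unset Printing Implicit Defensive.
Import Order.TTheory GRing.Theory Num.Theory.
Local Open Scope classical_set_scope.
Local Open Scope ring_scope.

Definition fpath_between (T : Type) (r : T -> T -> Prop) (x y : T) : Prop :=
  exists (n : nat) (p : nat -> T),
    p 0%N = x /\ p n = y /\ forall i, (i < n)%N -> r (p i) (p i.+1).

Definition simple_graph (V : choiceType) (adj : rel V) : Prop :=
  (forall x y, adj x y = adj y x) /\ (forall x, ~~ adj x x).

Definition locally_finite (V : choiceType) (adj : rel V) : Prop :=
  forall x, finite_set [set y | adj x y].

Definition connected_graph (V : choiceType) (adj : rel V) : Prop :=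
  forall x y, fpath_between (fun a b => adj a b) x y.

Definition infinite_graph (V : choiceType) : Prop := ~ finite_set [set: V].

Definition vertex_transitive (V : choiceType) (adj : rel V) : Prop :=
  forall x y, exists f : V -> V,
    bijective f /\ (forall u v, adj (f u) (f v) = adj u v) /\ f x = y.

(* neighbourhood and degree (meaningful for locally finite graphs) *)
Definition nbr (V : choiceType) (adj : rel V) (x : V) : {fset V} :=
  fset_set [set y | adj x y].
Definition deg (V : choiceType) (adj : rel V) (x : V) : nat := #|` nbr adj x|.

Definition harmonic (R : realType) (V : choiceType) (adj : rel V) (h : V -> R) :=
  forall x, h x = ((deg adj x)%:R)^-1 * \sum_(y <- nbr adj x) h y.

Definition bounded_harmonic_constant (R : realType) (V : choiceType) (adj : rel V) :=
  forall h : V -> R, (exists M : R, forall x, `|h x| <= M) ->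
    harmonic adj h -> exists c : R, forall x, h x = c.

Definition srw_path_prob (R : realType) (V : choiceType) (adj : rel V)
    (x : V) (a : nat -> V) (n : nat) : R :=
  ((a 0%N == x)%:R) *
  \prod_(i < n) (((adj (a i) (a i.+1))%:R) / ((deg adj (a i))%:R)).

Definition indep_srw (R : realType) (V : choiceType) (adj : rel V)
    (d : measure_display) (Omega : measurableType d) (P : probability Omega R)
    (x : V) (S1 S2 : nat -> Omega -> V) : Prop :=
  (forall i v, measurable [set w | S1 i w = v]) /\
  (forall i v, measurable [set w | S2 i w = v]) /\
  (forall (n : nat) (a b : nat -> V),
     P [set w | forall i, (i <= n)%N -> S1 i w = a i /\ S2 i w = b i] =
     (srw_path_prob R adj x a n * srw_path_prob R adj x b n)%:E).

Definition srw_finitely_many_intersections (R : realType) (V : choiceType)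
    (adj : rel V) : Prop :=
  forall (d : measure_display) (Omega : measurableType d)
         (P : probability Omega R) (x : V) (S1 S2 : nat -> Omega -> V),
    indep_srw adj P x S1 S2 ->
    {ae P, forall w, finite_set
       [set v | (exists i, S1 i w = v) /\ (exists j, S2 j w = v)]}.

Definition cyl_sets (I : Type) (T : pointedType) : set (set (I -> T)) :=
  [set A | exists (i : I) (t : T), A = [set f | f i = t]].

Definition cylType (I : Type) (T : pointedType) := g_sigma_algebraType (@cyl_sets I T).

(* edge configurations (omega (x,y) = edge xy present) and sandpile configs *)
Definition EConf (V : choiceType) := cylType (V * V)%type bool.
Definition SConf (V : choiceType) := cylType V nat.

Definition is_exhaustion (V : choiceType) (Vn : nat -> {fset V}) : Prop :=
  (forall n, (Vn n `<=` Vn n.+1)%fset) /\ (forall x, exists n, x \in Vn n).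

(* vertices of G_W: Some x for x in W, and the sink None *)
Definition collapse (V : choiceType) (W : {fset V}) (v : V) : option V :=
  if v \in W then Some v else None.

(* (oriented) edges of G_W: edges of G with at least one endpoint in W;
   edges with both endpoints outside W become loops at s and are removed *)
Definition wired_edges (V : choiceType) (adj : rel V) (W : {fset V}) : {fset (V * V)} :=
  fset_set [set p | adj p.1 p.2 /\ (p.1 \in W \/ p.2 \in W)].

Definition wired_conn (V : choiceType) (W : {fset V}) (T : set (V * V))
    (u v : option V) : Prop :=
  fpath_between (fun a b => exists e, T e /\ collapse W e.1 = a /\ collapse W e.2 = b) u v.

(* T (a symmetric set of oriented edges = a set of undirected edges of the
   multigraph G_W) is a spanning tree of G_W: it spans and connects all
   vertices, and it is acyclic (no edge lies on a cycle: removing any edge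
   disconnects its endpoints; this also covers parallel edges to the sink) *)
Definition wired_spanning_tree (V : choiceType) (adj : rel V) (W : {fset V})
    (T : set (V * V)) : Prop :=
  T `<=` [set p | p \in wired_edges adj W] /\
  (forall x y, T (x, y) -> T (y, x)) /\
  (forall x, x \in W -> wired_conn W T (Some x) None) /\
  (forall e, T e ->
     ~ wired_conn W (T `\` [set e; (e.2, e.1)]) (collapse W e.1) (collapse W e.2)).

Definition tree_of (V : choiceType) (adj : rel V) (W : {fset V})
    (S : {set wired_edges adj W}) : set (V * V) :=
  [set p | exists e : wired_edges adj W, e \in S /\ val e = p].

Definition ust_set (V : choiceType) (adj : rel V) (W : {fset V}) :
    {set {set wired_edges adj W}} :=
  [set S | `[< wired_spanning_tree adj W (tree_of S) >]].

Definition ust_cyl (R : realType) (V : choiceType) (adj : rel V) (W : {fset V})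
    (F : {fset (V * V)}) (b : V * V -> bool) : R :=
  (#|[set S in ust_set adj W |
       `[< forall p, p \in F -> `[< tree_of S p >] = b p >]]|)%:R /
  (#|ust_set adj W|)%:R.

Definition wsf_limit (R : realType) (V : choiceType) (adj : rel V)
    (mu : probability (EConf V) R) : Prop :=
  forall Vn : nat -> {fset V}, is_exhaustion Vn ->
  forall (F : {fset (V * V)}) (b : V * V -> bool),
    (fun n => (ust_cyl R adj (Vn n) F b)%:E) @ \oo -->
      mu [set w : EConf V | forall p, p \in F -> w p = b p].

Definition one_ended_components (V : choiceType) (adj : rel V) (w : V * V -> bool) : Prop :=
  let e := fun a b => adj a b && w (a, b) in
  forall p q : nat -> V,
    (forall i, e (p i) (p i.+1)) -> injective p ->
    (forall i, e (q i) (q i.+1)) -> injective q ->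
    fpath_between (fun a b => e a b) (p 0%N) (q 0%N) ->
    ~ finite_set [set v | (exists i, p i = v) /\ (exists j, q j = v)].

Definition wsf_one_ended (R : realType) (V : choiceType) (adj : rel V) : Prop :=
  exists mu : probability (EConf V) R,
    wsf_limit adj mu /\ {ae mu, forall w, one_ended_components adj w}.

(* configurations are eta : V -> nat, supported on W; deg_{G_W}(x) = deg_G(x) *)

Definition stable_conf (V : choiceType) (adj : rel V) (W : {fset V}) (eta : V -> nat) :=
  (forall x, x \in W -> (eta x < deg adj x)%N) /\ (forall x, x \notin W -> eta x = 0%N).

Definition topple (V : choiceType) (adj : rel V) (W : {fset V}) (x : V)
    (eta : V -> nat) : V -> nat :=
  fun y => if y == x then (eta y - deg adj x)%N
           else if (y \in W) && adj x y then (eta y).+1 else eta y.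

Definition topple_step (V : choiceType) (adj : rel V) (W : {fset V}) (eta eta' : V -> nat) :=
  exists x, x \in W /\ (deg adj x <= eta x)%N /\ eta' = topple adj W x eta.

Definition stabilizes_to (V : choiceType) (adj : rel V) (W : {fset V}) (eta xi : V -> nat) :=
  fpath_between (topple_step adj W) eta xi /\ stable_conf adj W xi.

Definition add_grain (V : choiceType) (x : V) (eta : V -> nat) : V -> nat :=
  fun y => if y == x then (eta y).+1 else eta y.

(* one move of the sandpile Markov chain with positive probability *)
Definition chain_step (V : choiceType) (adj : rel V) (W : {fset V}) (eta xi : V -> nat) :=
  exists x, x \in W /\ stabilizes_to adj W (add_grain x eta) xi.

Definition recurrent (V : choiceType) (adj : rel V) (W : {fset V}) (eta : V -> nat) :=
  stable_conf adj W eta /\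
  forall xi, fpath_between (chain_step adj W) eta xi ->
             fpath_between (chain_step adj W) xi eta.

Definition stable_space (V : choiceType) (adj : rel V) (W : {fset V}) :=
  {dffun forall x : W, 'I_(deg adj (val x))}.

Definition conf_of (V : choiceType) (adj : rel V) (W : {fset V})
    (c : stable_space adj W) : V -> nat :=
  fun v => match insub v with Some x => nat_of_ord (c x) | None => 0%N end.

Definition recurrent_set (V : choiceType) (adj : rel V) (W : {fset V}) :
    {set stable_space adj W} :=
  [set c | `[< recurrent adj W (conf_of c) >]].

Definition sandpile_cyl (R : realType) (V : choiceType) (adj : rel V) (W : {fset V})
    (A : {fset V}) (a : V -> nat) : R :=
  (#|[set c in recurrent_set adj W |
       `[< forall x, x \in A -> conf_of c x = a x >]]|)%:R /
  (#|recurrent_set adj W|)%:R.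

(* Main.v *)
Require Import Defs.
From HB Require Import structures.
From mathcomp Require Import all_boot all_order all_algebra finmap.
From mathcomp Require Import all_classical all_reals all_analysis.
From mathcomp Require Import zify lra.
Set Implicit Arguments. Unset Strict Implicit. Unset Printing Implicit Defensive.
Import Order.TTheory GRing.Theory Num.Theory numFieldNormedType.Exports.

(** The argument follows Jarai and Werning, "Minimal configurations and sandpile
    measures".  For a finite set [Q], burn a recurrent configuration of [G_n] without ever
    burning [Q]; let [W] be the set left unburnt.  Given [W], the configuration
    on [W] is uniform on a finite set which depends on [Q] and [W] only, and
    the number of possibilities outside [W] is a number of spanning trees.
    Hence the law of [W] is the law of the set of descendants of [Q] in the
    uniform spanning tree of [G_n] rooted at the sink, where [W] being the set
    of descendants is a cylinder event for the edges touching [W].  Its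
    probability therefore converges, and there is no loss of mass: an infinite
    set of descendants would give two disjoint infinite paths started in [Q].
    The limits of the cylinder probabilities are realized by a measure obtained
    from Lebesgue measure on [0, 1[. *)

Local Open Scope classical_set_scope.
Local Open Scope fset_scope.
Local Open Scope nat_scope.

(** * Counting and deletion-contraction *)

Section Count.
Implicit Types T : choiceType.

(** No burning bijection is used: bijections between configurations and trees depend on choices and
    look far away, whereas [count_trees] only equates cardinalities. It is stated for directed
    graphs with a sink and arbitrary base heights [lo], so that one identity serves [G_n] itself,
    the graph outside [W] (where [lo] records the edges lost to [W]) and the graph inside [W] (whose
    neighbour relation is not symmetric, since only vertices of [Q] see the sink). The number of
    outer trees over the number of all trees is the probability of containing one prescribed inner
    tree; it therefore does not depend on that tree, and it converges. Tightness is not proved in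
    finite volume. Summing over the sets [W] inside a ball of radius [k] leaves a gap, and the limit
    of this gap is bounded by the probability of an event of the limiting forest which decreases
    with [k]; one-endedness is applied to that forest only. The bounds do not mention the
    exhaustion, hence neither does the limit. *)

Definition count_set T (A : set T) : nat := #|` fset_set A|.

Lemma count_bij T T' (A : set T) (B : set T') (h : T -> T') (h' : T' -> T) :
  finite_set A ->
  (forall a, A a -> B (h a) /\ h' (h a) = a) ->
  (forall b, B b -> A (h' b) /\ h (h' b) = b) ->
  count_set A = count_set B.
Proof.
move=> finA hA hB; have -> : B = (h @` A)%classic.
  apply/seteqP; split=> [b Bb|_ [a Aa <-]]; last by have [] := hA a Aa.
  by have [Ab bE] := hB b Bb; exists (h' b).
rewrite /count_set fset_set_image// card_in_imfset//= => a b.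
rewrite !in_fset_set// !inE => Aa Ab eq_h.
by have [_ <-] := hA a Aa; have [_ <-] := hA b Ab; rewrite eq_h.
Qed.

Lemma count_split T (A P : set T) : finite_set A ->
  count_set A = count_set (A `&` P)%classic + count_set (A `\` P)%classic.
Proof.
move=> finA; rewrite /count_set.
have fI : finite_set (A `&` P)%classic by apply: sub_finite_set finA => x [].
have fD : finite_set (A `\` P)%classic by apply: sub_finite_set finA => x [].
rewrite -[A in LHS](setUIDK A P) fset_setU//.
rewrite cardfsU [X in _ - #|` X|](_ : _ = fset0) ?cardfs0 ?subn0//.
apply/fsetP => x; rewrite !inE !in_fset_set// in_setI in_setD; apply/negP.
by move=> /andP[/andP[_ ->]]; rewrite andbF.
Qed.

Lemma count_sub T (A B : set T) : finite_set B -> (A `<=` B)%classic ->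
  count_set A <= count_set B.
Proof.
move=> finB AB; have finA := sub_finite_set AB finB.
by rewrite /count_set; apply: fsubset_leq_card; rewrite -fset_set_sub.
Qed.

Lemma count_prod T T' (A : set T) (B : set T') : finite_set A -> finite_set B ->
  count_set (A `*` B)%classic = count_set A * count_set B.
Proof.
move=> fA fB; rewrite /count_set fset_setX//; set X := fset_set A; set Y := fset_set B.
have -> : X `*` Y = [fset x in [seq (a, b) | a <- X, b <- Y]].
  apply/fsetP => -[a b]; rewrite !inE /=.
  by apply/andP/allpairsP => [[aX bY]|[[a' b'] [aX bY [-> ->]]]//]; exists (a, b).
rewrite card_fseq undup_id ?size_allpairs//.
by apply: allpairs_uniq; rewrite ?fset_uniq// => -[a b] [a' b'].
Qed.

Lemma count0 T : count_set (@set0 T) = 0.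
Proof. by rewrite /count_set fset_set0 cardfs0. Qed.

Lemma count1 T (x : T) : count_set [set x] = 1.
Proof. by rewrite /count_set fset_set1 cardfs1. Qed.

End Count.

Lemma finite_funs (V : choiceType) (T : choiceType) (U : {fset V}) (c : V -> T)
    (K : V -> {fset T}) :
  finite_set [set f : V -> T | (forall x, x \notin U -> f x = c x) /\
                               (forall x, x \in U -> f x \in K x)].
Proof.
pose BK := \bigcup_(x <- U) K x.
pose glue (g : {ffun U -> option BK}) : V -> T := fun x =>
  if insub x is Some u then (if g u is Some t then val t else c x) else c x.
apply: (@sub_finite_set _ _ (glue @` setT)%classic); last exact: finite_image.
move=> f [fc fK]; exists [ffun u : U => insub (f (val u))] => //.
apply/funext => x; rewrite /glue; case: insubP => [u xU ux|xU]; last by rewrite fc.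
rewrite ffunE ux; case: insubP => [t _ //|/negP[]].
by apply/bigfcupP; exists x; rewrite ?xU ?fK.
Qed.

(** * Burnable configurations and trees of a finite directed graph with a sink *)

Section Burning.
Variable V : choiceType.
Implicit Types (U F W : {fset V}) (r : V -> {fset V}) (f g : V -> V)
  (lo eta : V -> nat).

Definition exits U f x := exists i, iter i f x \notin U.

Lemma exits_out U f x : x \notin U -> exits U f x.
Proof. by exists 0. Qed.

Lemma exits_step U f x : exits U f (f x) -> exits U f x.
Proof. by move=> [i ix]; exists i.+1; rewrite iterSr. Qed.

Lemma exits_ind U f (P : V -> Prop) :
  (forall x, x \notin U -> P x) -> (forall x, x \in U -> P (f x) -> P x) ->
  forall x, exits U f x -> P x.
Proof.
move=> Pout Pin x [i]; elim: i x => [|i IH] x; first exact: Pout.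
have [xU|/Pout//] := boolP (x \in U).
by rewrite iterSr => /IH; apply: Pin.
Qed.

(* Spanning trees of [U] wired to its complement, encoded by the map sending a
   vertex of [U] to its parent and fixing the other vertices. *)
Definition trees U r : set (V -> V) :=
  [set f | [/\ forall x, x \notin U -> f x = x,
               forall x, x \in U -> f x \in r x & forall x, exits U f x]].

(** Absence of forbidden subconfigurations. The base height [lo] stands for neighbours that are
    never burnt, and [r] may be asymmetric. *)
Definition burnable U r lo eta := forall F, F `<=` U -> F != fset0 ->
  exists2 x, x \in F & lo x + #|` r x `&` F| <= eta x.

Definition confs U r lo : set (V -> nat) :=
  [set eta | [/\ forall x, x \notin U -> eta x = 0,
                 forall x, x \in U -> eta x < lo x + #|` r x| &
                 burnable U r lo eta]].

Lemma finite_trees U r : finite_set (trees U r).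
Proof. by apply: sub_finite_set (finite_funs U id r) => f []. Qed.

Lemma finite_confs U r lo : finite_set (confs U r lo).
Proof.
apply: sub_finite_set (finite_funs U (fun=> 0)
  (fun x => [fset i in iota 0 (lo x + #|` r x|)])) => f [f0 fr _].
by split=> // x xU; rewrite !inE mem_iota /= fr.
Qed.

Definition del_edge r x0 y0 x := if x == x0 then r x `\ y0 else r x.

Lemma trees_step U r x0 y0 : x0 \in U -> y0 \in r x0 -> y0 \notin U ->
  count_set (trees U r) =
  count_set (trees (U `\ x0) r) + count_set (trees U (del_edge r x0 y0)).
Proof.
move=> x0U y0r y0U.
rewrite (@count_split _ _ [set f | f x0 = y0] (finite_trees U r)); congr (_ + _).
  apply: (@count_bij _ _ _ _ (fun f x => if x == x0 then x0 else f x)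
                             (fun f x => if x == x0 then y0 else f x)).
  - by apply: sub_finite_set (finite_trees U r) => f [].
  - move=> f [[f_id f_r f_ex] fx0]; split; last first.
      by apply/funext => x; case: eqVneq => // ->.
    split=> [x|x|x].
    + by rewrite !inE; case: eqVneq => //= _; apply: f_id.
    + by rewrite !inE; case: eqVneq => //= _; apply: f_r.
    + apply: exits_ind (f_ex x) => {}x xU.
        by apply: exits_out; rewrite !inE (negbTE xU) andbF.
      have [->|xx0] := eqVneq x x0; first by move=> _; apply: exits_out; rewrite !inE eqxx.
      by move=> fx_ex; apply: exits_step; rewrite /= (negbTE xx0).
  - move=> f [f_id f_r f_ex]; split; last first.
      by apply/funext => x; case: eqVneq => // ->; rewrite f_id// !inE eqxx.
    split; last by rewrite /= eqxx.
    split=> [x|x xU|x].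
    + case: eqVneq => [->|_]; first by rewrite x0U.
      by move=> xU; apply: f_id; rewrite !inE (negbTE xU) andbF.
    + by case: eqVneq => [->//|xx0]; apply: f_r; rewrite !inE xx0.
    + apply: exits_ind (f_ex x) => {}x; rewrite !inE.
        case: eqVneq => [-> _|_ /= xU]; last exact: exits_out.
        by apply: exits_step; apply: exits_out; rewrite eqxx.
      by move=> /andP[/negbTE xx0 _] fx_ex; apply: exits_step; rewrite /= xx0.
congr count_set; apply/seteqP; split=> f /=.
  move=> [[f_id f_r f_ex] fx0]; split=> // x xU; rewrite /del_edge.
  case: eqVneq => [xx0|_]; last exact: f_r.
  by rewrite !inE f_r// andbT; subst x; apply/eqP.
move=> [f_id f_r f_ex]; split.
  split=> // x /f_r; rewrite /del_edge; case: eqVneq => // _.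
  by rewrite !inE => /andP[].
by have := f_r _ x0U; rewrite /del_edge eqxx !inE => /andP[/eqP].
Qed.

Lemma fsetID1 (A F : {fset V}) y : y \notin F -> (A `\ y) `&` F = A `&` F.
Proof.
move=> yF; apply/fsetP => x; rewrite !inE.
by case: eqVneq => //= ->; rewrite (negbTE yF) !andbF.
Qed.

(** If [eta x0] has its maximal value [m], then [x0] burns in every [F] containing it, because [y0]
    is never in [F]; so [x0] may join the sink. If not, [eta x0] satisfies the bound of the graph
    without the edge, and deleting the edge does not change [r x0] inside [F]. *)
Lemma confs_step U r lo x0 y0 : x0 \in U -> y0 \in r x0 -> y0 \notin U ->
  count_set (confs U r lo) =
  count_set (confs (U `\ x0) r lo) + count_set (confs U (del_edge r x0 y0) lo).
Proof.
move=> x0U y0r y0U; set m := lo x0 + #|` r x0 `\ y0|.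
have rx0 : #|` r x0| = #|` r x0 `\ y0|.+1 by rewrite (cardfsD1 y0) y0r.
rewrite (@count_split _ _ [set eta | eta x0 = m] (finite_confs U r lo)); congr (_ + _).
  apply: (@count_bij _ _ _ _ (fun (f : V -> nat) x => if x == x0 then 0 else f x)
                             (fun (f : V -> nat) x => if x == x0 then m else f x)).
  - by apply: sub_finite_set (finite_confs U r lo) => f [].
  - move=> f [[f_id f_r f_b] fx0]; split; last first.
      by apply/funext => x; case: eqVneq => // ->.
    split=> [x|x|F FU F0].
    + by rewrite !inE; case: eqVneq => //= _; apply: f_id.
    + by rewrite !inE; case: eqVneq => //= _; apply: f_r.
    + have [|x xF xb] := f_b F _ F0; first exact: fsubset_trans FU (fsubD1set _ _).
      exists x => //; have := fsubsetP FU _ xF; rewrite !inE.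
      by case: eqVneq.
  - move=> f [f_id f_r f_b]; split; last first.
      by apply/funext => x; case: eqVneq => // ->; rewrite f_id// !inE eqxx.
    split; last by rewrite /= eqxx.
    split=> [x|x xU|F FU F0].
    + case: eqVneq => [->|_]; first by rewrite x0U.
      by move=> xU; apply: f_id; rewrite !inE (negbTE xU) andbF.
    + case: eqVneq => [->|xx0]; first by rewrite /m rx0 addnS.
      by apply: f_r; rewrite !inE xx0.
    + have [x0F|x0F] := boolP (x0 \in F).
        exists x0 => //; rewrite eqxx /m leq_add2l -(@fsetID1 _ _ y0).
          exact/fsubset_leq_card/fsubsetIl.
        by apply: contra y0U; apply: (fsubsetP FU).
      have [|x xF xb] := f_b F _ F0.
        by rewrite fsubsetD1 FU.
      by exists x => //; case: eqVneq => // xx0; rewrite -xx0 xF in x0F.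
congr count_set; apply/seteqP; split=> f /=.
  move=> [[f_id f_r f_b] fx0]; split=> // [x xU|F FU F0]; rewrite /del_edge.
    case: eqVneq => [xx0|_]; last exact: f_r.
    have := f_r _ xU; subst x; rewrite rx0 addnS ltnS leq_eqVlt => /orP[/eqP//|].
    by [].
  have [x xF xb] := f_b F FU F0; exists x => //; case: eqVneq => // _.
  by rewrite fsetID1//; apply: contra y0U; apply: (fsubsetP FU).
move=> [f_id f_r f_b]; split.
  split=> // [x xU|F FU F0].
    have := f_r x xU; rewrite /del_edge; case: eqVneq => // -> /leq_trans; apply.
    by rewrite leq_add2l rx0.
  have [x xF xb] := f_b F FU F0; exists x => //; move: xb; rewrite /del_edge.
  by case: eqVneq => // _; rewrite fsetID1//; apply: contra y0U; apply: (fsubsetP FU).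
move=> fx0; have := f_r _ x0U; rewrite /del_edge eqxx fx0 /m.
by rewrite ltnn.
Qed.

(* Deletion-contraction on an edge from [x0 \in U] to [y0 \notin U]: the
   configurations with [eta x0] maximal correspond to the trees with
   [f x0 = y0]. *)
Theorem count_trees U r lo : count_set (trees U r) = count_set (confs U r lo).
Proof.
have [n] := ubnP (#|` U| + \sum_(x <- U) #|` r x|).
elim: n U r => // n IH U r; rewrite ltnS => ln.
have [->|U0] := eqVneq U fset0.
  have -> : trees fset0 r = [set id].
    apply/seteqP; split=> [f [f_id _ _]|_ ->]; first by apply/funext => x; apply: f_id.
    by split=> // x; apply: exits_out.
  rewrite [confs _ _ _](_ : _ = [set (fun=> 0)]) ?count1//.
  apply/seteqP; split=> [f [f_id _ _]|_ ->]; first by apply/funext => x; apply: f_id.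
  by split=> // F; rewrite fsubset0 => ->.
have [[x0 [y0 [x0U y0r y0U]]]|noexit] :=
    pselect (exists x0 y0, [/\ x0 \in U, y0 \in r x0 & y0 \notin U]).
  rewrite (trees_step x0U y0r y0U) (confs_step lo x0U y0r y0U).
  rewrite (big_fsetD1 x0 x0U)/= in ln.
  rewrite (cardfsD1 x0) x0U in ln; congr (_ + _); apply: IH.
    lia.
  rewrite (cardfsD1 x0) x0U (big_fsetD1 x0 x0U)/= {1}/del_edge eqxx.
  rewrite (cardfsD1 y0 (r x0)) y0r /= in ln.
  rewrite (@eq_big_seq _ _ _ _ _ _ (fun x => #|` r x|)); first by move: ln; set s := \sum_(_ <- _) _; lia.
  by move=> x; rewrite /del_edge !inE => /andP[/negbTE ->].
(* When no edge leaves [U], both sides are zero: no parent map can exit [U], and [F = U] is a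
   forbidden subconfiguration. *)
have inU x y : x \in U -> y \in r x -> y \in U.
  by move=> xU yr; apply/negPn/negP => yU; apply: noexit; exists x, y.
rewrite [trees _ _](_ : _ = set0); last first.
  apply/seteqP; split=> // f [f_id f_r f_ex]; have [x xU] := fset0Pn _ U0.
  suff : x \notin U by rewrite xU.
  apply: (@exits_ind U f (fun x => x \notin U)) (f_ex x) => // {}x {}xU.
  by rewrite (inU x)// f_r.
rewrite [confs _ _ _](_ : _ = set0) ?count0//.
apply/seteqP; split=> // f [_ f_r f_b]; have [x xU] := f_b U (fsubset_refl U) U0.
rewrite leqNgt (fsetIidPl _) ?f_r//; apply/fsubsetP => y; exact: inU.
Qed.

End Burning.

(** * Dhar's burning criterion for recurrence *)

Section Paths.
Variables (T : Type) (s : T -> T -> Prop).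

Fixpoint nsteps n a b : Prop :=
  if n is n'.+1 then exists2 c, s a c & nsteps n' c b else a = b.

Lemma fpath_betweenP a b : fpath_between s a b <-> exists n, nsteps n a b.
Proof.
split=> [[n [p [<- [<-]]]]|[n]].
  elim: n p => [|n IH] p ps; first by exists 0.
  have [i|m pm] := IH (fun i => p i.+1); first by move=> ilt; apply: ps.
  by exists m.+1, (p 1) => //; apply: ps.
elim: n a => [|n IH] a /= => [->|[c ac /IH[m [p [p0 [pm ps]]]]]].
  by exists 0, (fun=> b).
exists m.+1, (fun i => if i is i'.+1 then p i' else a); split=> //; split=> // -[_|i].
  by rewrite p0.
exact: ps.
Qed.

Lemma fpath0 a : fpath_between s a a.
Proof. by apply/fpath_betweenP; exists 0. Qed.

Lemma fpath_cons a b c : s a b -> fpath_between s b c -> fpath_between s a c.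
Proof. by move=> ab /fpath_betweenP[n bc]; apply/fpath_betweenP; exists n.+1, b. Qed.

Lemma fpath_ind (P : T -> Prop) z :
  P z -> (forall a b, s a b -> P b -> P a) -> forall a, fpath_between s a z -> P a.
Proof.
move=> Pz Ps a /fpath_betweenP[n]; elim: n a => [|n IH] a /= => [->//|[c ac /IH]].
exact: Ps.
Qed.

Lemma fpath_trans a b c :
  fpath_between s a b -> fpath_between s b c -> fpath_between s a c.
Proof.
move=> ab bc; apply: (@fpath_ind (fun x => fpath_between s x c) b) ab => // x y.
exact: fpath_cons.
Qed.

Lemma fpath_preserve (P : T -> Prop) a b :
  (forall x y, s x y -> P x -> P y) -> fpath_between s a b -> P a -> P b.
Proof.
move=> Ps; apply: (@fpath_ind (fun x => P x -> P b)) => // x y xy yb Px.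
exact/yb/Ps/Px.
Qed.

(** The abstract form of the abelian property: with one-step diamonds, any first step is the start
    of a path of the same length to the terminal state. The length bounds the inductions below. *)
Lemma nsteps_diamond n a b z :
  (forall a b c, s a b -> s a c -> b = c \/ exists2 d, s b d & s c d) ->
  (forall x, ~ s z x) -> nsteps n a z -> s a b ->
  exists2 m, n = m.+1 & nsteps m b z.
Proof.
move=> dia zt; elim: n a b => [|n IH] a b /= => [-> /zt//|[c ac cz] ab].
exists n => //; have [->//|[d bd cd]] := dia _ _ _ ab ac.
by have [m -> dz] := IH _ _ cz cd; exists d.
Qed.

End Paths.

Section Dhar.
Variables (V : choiceType) (adj : rel V).
Hypothesis adj_simple : simple_graph adj.
Hypothesis adj_lf : locally_finite adj.
Hypothesis adj_conn : connected_graph adj.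
Implicit Types (U F W : {fset V}) (eta xi k j : V -> nat).

Lemma in_nbr x y : (y \in nbr adj x) = adj x y.
Proof. by rewrite in_fset_set//; apply/idP/idP; rewrite inE. Qed.

Lemma adjC x y : adj x y = adj y x.
Proof. exact: adj_simple.1. Qed.

Lemma adj_irr x : adj x x = false.
Proof. exact/negbTE/adj_simple.2. Qed.

Lemma boundary F v : F != fset0 -> v \notin F ->
  exists x y, [/\ x \in F, y \notin F & adj x y].
Proof.
move=> /fset0Pn[u uF] vF; apply: contrapT => noF.
have : v \in F; last by rewrite (negbTE vF).
apply: (@fpath_preserve _ _ (fun z => z \in F) _ _ _ (adj_conn u v) uF) => x y xy xF.
by apply/negPn/negP => yF; apply: noF; exists x, y.
Qed.

Lemma card_nbrI_lt x y F : adj x y -> y \notin F ->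
  #|` nbr adj x `&` F| < deg adj x.
Proof.
move=> xy yF; apply: fproper_ltn_card; rewrite fproperE fsubsetIl /=.
apply/negP => /fsubsetP/(_ y); rewrite !inE in_nbr xy (negbTE yF) => /(_ isT).
by [].
Qed.

Variables (W : {fset V}) (v0 : V).
Hypothesis v0W : v0 \notin W.

Lemma deg_gt0 x : x \in W -> 0 < deg adj x.
Proof.
move=> xW; have [] := @boundary [fset x] v0.
- by apply/fset0Pn; exists x; rewrite inE.
- by rewrite inE; apply: contraNneq v0W => ->.
move=> _ [y [/fset1P-> _ xy]]; rewrite /deg cardfs_gt0.
by apply/fset0Pn; exists y; rewrite in_nbr.
Qed.

(** Only the off-diagonal part of the Laplacian: the grains that [x] receives when each [y] of [W]
    topples [k y] times. *)
Definition lap k x := \sum_(y <- nbr adj x `&` W) k y.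

Lemma lapD k j x : lap (fun z => k z + j z) x = lap k x + lap j x.
Proof. exact: big_split. Qed.

Lemma lapM c k x : lap (fun z => c * k z) x = c * lap k x.
Proof. by rewrite /lap big_distrr. Qed.

Lemma lap1 v x : v \in W -> lap (fun z => z == v) x = adj x v.
Proof.
move=> vW; rewrite /lap -in_nbr.
have [vx|vx] := boolP (v \in nbr adj x).
  rewrite (big_fsetD1 v) /= ?eqxx ?inE ?vx// big1_fset// => y.
  by rewrite !inE => /andP[/negbTE ->].
rewrite big1_fset// => y; rewrite inE => /andP[yx _] _.
by case: eqVneq => // yv; rewrite -yv yx in vx.
Qed.

Lemma lap_ext k j x : {in W, k =1 j} -> lap k x = lap j x.
Proof. by move=> kj; apply: eq_big_seq => y; rewrite inE => /andP[_ /kj]. Qed.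

(** Strictness spreads inward from the boundary of [W]: the constant 1 is strict at a vertex with a
    neighbour outside [W], and if some [k] is strict at [y], lowering a multiple of it at [y] makes
    it strict at the neighbours of [y]. *)
Lemma superharmonic1 x : x \in W -> exists k,
  (forall z, z \in W -> lap k z <= deg adj z * k z) /\ lap k x < deg adj x * k x.
Proof.
move=> xW; apply: contrapT => xP.
pose P x := exists k,
  (forall z, z \in W -> lap k z <= deg adj z * k z) /\ lap k x < deg adj x * k x.
pose F := [fset x in W | ~~ `[< P x >]].
have [||u [y [+ yF uy]]] := @boundary F v0.
- by apply/fset0Pn; exists x; rewrite !inE xW; apply/negP => /asboolP.
- by rewrite !inE (negbTE v0W).
rewrite !inE => /andP[uW /asboolP]; apply.
have [yW|yW] := boolP (y \in W); last first.
  have lap1E z : lap (fun=> 1) z = #|` nbr adj z `&` W|.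
    by rewrite /lap big_const_seq count_predT iter_addn_0 mul1n.
  exists (fun=> 1); split=> [z _|]; rewrite lap1E muln1.
    exact/fsubset_leq_card/fsubsetIl.
  exact: card_nbrI_lt uy yW.
move: yF; rewrite !inE yW /= negbK => /asboolP[k [k_sup k_y]].
have ky : 0 < k y by case: (k y) k_y => //; rewrite muln0.
(* The factor raises the gap at [y] to at least [deg adj y + 1], which absorbs the loss [deg adj y]
   caused by subtracting 1 there. *)
pose k2 z := (deg adj y).+1 * k z - (z == y).
have k2E z : (deg adj y).+1 * k z = k2 z + (z == y).
  by rewrite /k2 subnK//; case: eqVneq => // ->; rewrite muln_gt0.
have lapk2 z : (deg adj y).+1 * lap k z = lap k2 z + adj z y.
  by rewrite -lapM -(lap1 _ yW) -lapD; apply: lap_ext => t _; rewrite k2E.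
exists k2; split=> [z zW|].
  have := lapk2 z; have := k2E z; have := k_sup z zW.
  case: eqVneq => [->|_]; last by case: (adj z y); nia.
  by rewrite adj_irr; nia.
have := lapk2 u; have := k2E u; have := k_sup u uW; rewrite uy.
by case: eqVneq => [uy'|_]; [rewrite uy' adj_irr in uy|nia].
Qed.

(** Such a [k] makes [lift eta k] at least [deg adj x] at every site of [W], hence above [max_conf],
    whatever [eta] is. *)
Lemma superharmonic : exists k,
  forall x, x \in W -> lap k x + deg adj x <= deg adj x * k x.
Proof.
have [k [k_sup k_lt]] : exists k, (forall z, z \in W -> lap k z <= deg adj z * k z) /\
    forall z, z \in W -> z \in enum_fset W -> lap k z < deg adj z * k z.
  elim: (enum_fset W) => [|x s [k [k_sup k_s]]].
    exists (fun=> 0); split=> // z _; rewrite /lap big1_seq//.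
  have [xW|xW] := boolP (x \in W); last first.
    exists k; split=> // z zW; rewrite inE => /orP[/eqP zx|/k_s]; last exact.
    by rewrite -zx zW in xW.
  have [k1 [k1_sup k1_x]] := superharmonic1 xW.
  exists (fun z => k z + k1 z); split=> [z zW|z zW]; rewrite lapD mulnDr.
    by apply: leq_add; [apply: k_sup|apply: k1_sup].
  rewrite inE => /orP[/eqP ->|zs].
    by rewrite -addnS leq_add//; apply: k_sup.
  by rewrite -addSn leq_add//; [apply: k_s|apply: k1_sup].
(* A strict inequality is a gap of at least 1; multiplication by [D], which dominates every degree,
   turns it into a gap of at least [deg adj x]. *)
pose D := \sum_(x <- W) deg adj x.
exists (fun x => D * k x) => x xW; have := k_lt x xW xW.
have : deg adj x <= D by rewrite /D (big_fsetD1 x)//= leq_addr.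
rewrite lapM; nia.
Qed.

Definition vanish eta := forall x, x \notin W -> eta x = 0.

Lemma topple_vanish eta x : x \in W -> vanish eta -> vanish (topple adj W x eta).
Proof.
move=> xW eta0 y yW; rewrite /topple (negbTE yW) eta0//.
by case: eqVneq => // yx; rewrite yx xW in yW.
Qed.

Lemma add_vanish eta x : x \in W -> vanish eta -> vanish (add_grain x eta).
Proof.
move=> xW eta0 y yW; rewrite /add_grain eta0//.
by case: eqVneq => // yx; rewrite yx xW in yW.
Qed.

Lemma topple_diamond a b c : topple_step adj W a b -> topple_step adj W a c ->
  b = c \/ exists2 d, topple_step adj W b d & topple_step adj W c d.
Proof.
move=> [x [xW [xa ->]]] [y [yW [ya ->]]].
have [->|xy] := eqVneq x y; first by left.
right; exists (topple adj W y (topple adj W x a)).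
  exists y; split=> //; split=> //; rewrite {1}/topple eq_sym (negbTE xy).
  by case: ifP => // _; apply: leqW.
exists x; split=> //; split.
  by rewrite {1}/topple (negbTE xy); case: ifP => // _; apply: leqW.
apply/funext => z; rewrite /topple; case: (eqVneq z y) => [->|zy].
  rewrite eq_sym (negbTE xy); case: ifP => // _; lia.
by case: (eqVneq z x) => [->|zx]; do ?case: ifP => //; lia.
Qed.

Lemma stable_no_step eta : stable_conf adj W eta -> forall xi, ~ topple_step adj W eta xi.
Proof. by move=> [es _] xi [x [xW [+ _]]]; rewrite leqNgt es. Qed.

Lemma topple_add x a e : deg adj x <= a x ->
  topple adj W x (fun z => a z + e z) = (fun z => topple adj W x a z + e z).
Proof.
move=> xa; apply/funext => z; rewrite /topple.
by case: eqVneq => [->|_]; [lia|case: ifP => _; lia].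
Qed.

(** A vertex unstable in [a] is unstable in [a + e], so its toppling can be done first without
    changing the final state [eta]. Each such toppling shortens the remaining path, which also
    proves that stabilizing [a] terminates. *)
Lemma stabilize_part n a e eta : vanish a -> stable_conf adj W eta ->
  nsteps (topple_step adj W) n (fun z => a z + e z) eta ->
  exists2 a', stabilizes_to adj W a a' &
    exists m, nsteps (topple_step adj W) m (fun z => a' z + e z) eta.
Proof.
move=> + es; elim: n a => [|n IH] a a0 ae;
  (have [a_s|a_s] := pselect (forall x, x \in W -> a x < deg adj x);
   [by exists a; [split=> //; exact: fpath0|eexists; exact: ae]|]).
all: have [x xW xa] : exists2 x, x \in W & deg adj x <= a x
  by apply: contrapT => nx; apply: a_s => x xW; rewrite ltnNge; apply/negP => xa;
     apply: nx; exists x.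
all: have st : topple_step adj W (fun z => a z + e z) (fun z => topple adj W x a z + e z)
  by exists x; split=> //; rewrite topple_add//; split=> //; rewrite (leq_trans xa)// leq_addr.
all: have [m E {}ae] := nsteps_diamond topple_diamond (stable_no_step es) ae st.
  by [].
case: E ae => <- ae.
have [a' [aa' a's] [l a'e]] := IH _ (topple_vanish xW a0) ae.
exists a'; last by exists l.
by split=> //; apply: fpath_cons aa'; exists x.
Qed.

(** Adding many grains and then stabilizing can be replaced by moves of the chain, one grain at a
    time: stabilize after the first grain by [stabilize_part] and recurse on the remaining
    grains. *)
Lemma add_chain xi e eta : stable_conf adj W xi -> stable_conf adj W eta ->
  vanish e -> fpath_between (topple_step adj W) (fun z => xi z + e z) eta ->
  fpath_between (chain_step adj W) xi eta.
Proof.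
have [n] := ubnP (\sum_(x <- W) e x).
elim: n xi e => // n IH xi e en xi_s eta_s e0 path.
have [[x xW ex]|ne] := pselect (exists2 x, x \in W & 0 < e x); last first.
  have eE z : xi z + e z = xi z.
    have [zW|/e0->] := boolP (z \in W); last by rewrite addn0.
    by case: (posnP (e z)) => [->|ez]; [rewrite addn0|case: ne; exists z].
  have {path} := path; rewrite (_ : (fun z => _) = xi); last exact/funext.
  move=> /fpath_betweenP[[/= ->|m [c /(stable_no_step xi_s)]//]].
  exact: fpath0.
pose e' z := e z - (z == x).
have e'E z : e z = e' z + (z == x) by rewrite /e' subnK//; case: eqVneq => // ->.
have /fpath_betweenP[m pm] := path.
rewrite (_ : (fun z => _) = (fun z => add_grain x xi z + e' z)) in pm; last first.
  by apply/funext => z; rewrite e'E /add_grain; case: eqVneq => _; lia.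
have [xi' xi_st [l pl]] := stabilize_part (add_vanish xW xi_s.2) eta_s pm.
apply: (@fpath_cons _ _ _ xi'); first by exists x.
apply: (IH _ e') => //.
- move: en; rewrite (big_fsetD1 x)//= [in X in _ -> X](big_fsetD1 x)//=.
  rewrite (@eq_big_seq _ _ _ _ _ e e').
    by move: (e'E x); rewrite eqxx; set b := \sum_(_ <- _) _; lia.
  by move=> z; rewrite !inE e'E => /andP[/negbTE-> _]; rewrite addn0.
- by case: xi_st.
- by move=> z zW; rewrite /e' e0.
- by apply/fpath_betweenP; exists l.
Qed.

(** Only sets [F] containing the toppled [x] could suffer. The vertex [y] that burns in [F] without
    [x] gains a grain exactly when [x] is its neighbour, which pays for putting [x] back; for [F]
    reduced to [x] there is nothing to pay. *)
Lemma burnable_topple eta x : x \in W -> deg adj x <= eta x ->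
  burnable W (nbr adj) (fun=> 0) eta ->
  burnable W (nbr adj) (fun=> 0) (topple adj W x eta).
Proof.
move=> xW xe eb F FW F0.
have [xF|xF] := boolP (x \in F); last first.
  have [y yF yb] := eb F FW F0; exists y => //; apply: leq_trans yb _.
  rewrite /topple; case: eqVneq => [yx|_]; first by rewrite -yx yF in xF.
  by case: ifP.
have [F1|F1] := eqVneq (F `\ x) fset0.
  exists x => //; rewrite (_ : _ `&` _ = fset0) ?cardfs0//.
  apply/fsetP => y; rewrite !inE in_nbr; apply/negP => /andP[xy yF].
  have : y \in F `\ x by rewrite !inE yF andbT; apply: contraTneq xy => ->; rewrite adj_irr.
  by rewrite F1.
have [|y + yb] := eb (F `\ x) _ F1; first exact: fsubset_trans (fsubD1set _ _) FW.
rewrite !inE => /andP[yx yF]; exists y => //.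
rewrite /topple (negbTE yx) (fsubsetP FW _ yF) /=.
move: yb; rewrite !add0n (cardfsD1 x (_ `&` F)) !inE xF in_nbr adjC.
rewrite (_ : (nbr adj y `&` F) `\ x = nbr adj y `&` (F `\ x)); last first.
  by apply/fsetP => z; rewrite !inE; case: (z == x); rewrite ?andbF.
by case: (adj x y) => //= yb; rewrite ltnS.
Qed.

Lemma burnable_add eta x :
  burnable W (nbr adj) (fun=> 0) eta ->
  burnable W (nbr adj) (fun=> 0) (add_grain x eta).
Proof.
move=> eb F FW F0; have [y yF yb] := eb F FW F0; exists y => //.
by apply: leq_trans yb _; rewrite /add_grain; case: ifP.
Qed.

Definition max_conf x := if x \in W then (deg adj x).-1 else 0.

Lemma max_conf_stable : stable_conf adj W max_conf.
Proof.
split=> x; rewrite /max_conf; last by move=> /negbTE ->.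
by move=> xW; rewrite xW prednK// deg_gt0.
Qed.

Lemma max_conf_reach xi : stable_conf adj W xi ->
  fpath_between (chain_step adj W) xi max_conf.
Proof.
move=> xi_s; apply: (@add_chain _ (fun z => max_conf z - xi z)) => //.
- exact: max_conf_stable.
- by move=> z zW; rewrite /max_conf (negbTE zW).
rewrite (_ : (fun z => _) = max_conf); first exact: fpath0.
apply/funext => z; rewrite subnKC// /max_conf; case: ifP => [zW|/negbT zW].
  by have := xi_s.1 z zW; lia.
by rewrite xi_s.2.
Qed.

Lemma max_conf_burnable : burnable W (nbr adj) (fun=> 0) max_conf.
Proof.
move=> F FW F0; have [|x [y [xF yF xy]]] := @boundary F v0 F0.
  by apply: contra v0W; apply: (fsubsetP FW).
exists x => //; rewrite /max_conf (fsubsetP FW _ xF) add0n -ltnS prednK; last first.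
  exact/deg_gt0/(fsubsetP FW).
exact: card_nbrI_lt xy yF.
Qed.

Lemma chain_burnable a b : fpath_between (chain_step adj W) a b ->
  burnable W (nbr adj) (fun=> 0) a -> burnable W (nbr adj) (fun=> 0) b.
Proof.
apply: fpath_preserve => {a b} a b [x [xW [ab _]]] /(burnable_add x) ax.
apply: fpath_preserve ab ax => {a}a c [y [yW [ya ->]]].
exact: burnable_topple.
Qed.

Definition lift eta k x := if x \in W then eta x + deg adj x * k x - lap k x else 0.

(* A burnable configuration is reached by legal topplings from [eta] plus the
   Laplacian of [k]: among the vertices with the largest number of topplings
   still to be done, a burnable one is unstable. *)
Lemma lift_topple eta k : vanish eta -> burnable W (nbr adj) (fun=> 0) eta ->
  (forall x, x \in W -> lap k x <= eta x + deg adj x * k x) ->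
  fpath_between (topple_step adj W) (lift eta k) eta.
Proof.
move=> eta0 eb; have [n] := ubnP (\sum_(x <- W) k x).
elim: n k => // n IH k kn kge.
have [k0|k0] := pselect (forall x, x \in W -> k x = 0).
  rewrite (_ : lift _ _ = eta); first exact: fpath0.
  apply/funext => x; rewrite /lift; case: ifP => [xW|/negbT/eta0//].
  rewrite k0// (@lap_ext _ (fun=> 0))// /lap big1_seq ?muln0 ?addn0 ?subn0//.
have [x1 x1W kx1] : exists2 x, x \in W & 0 < k x.
  apply: contrapT => nx; apply: k0 => x xW; case: (posnP (k x)) => // kx.
  by case: nx; exists x.
pose m := \max_(x <- W) k x.
have km x : x \in W -> k x <= m by move=> xW; apply: leq_bigmax_seq.
pose F := [fset x in W | k x == m].
have FW : F `<=` W by apply/fsubsetP => x; rewrite !inE => /andP[].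
have F0 : F != fset0.
  have : exists2 x, x \in enum_fset W & k x = m.
    have := x1W; rewrite /m -[x1 \in W]/(x1 \in enum_fset W).
    elim: (enum_fset W) x1 {kx1 x1W km F FW} => // y s IHs x1 _; rewrite big_cons.
    case: s IHs => [_|z s IHs].
      by exists y; rewrite ?inE ?eqxx// big_nil maxn0.
    have [w ws <-] := IHs z (mem_head _ _).
    case: (leqP (k y) (k w)) => yw.
      by exists w; rewrite ?(maxn_idPr yw)// in_cons ws orbT.
    by exists y; rewrite ?mem_head// (maxn_idPl (ltnW yw)).
  by move=> [x xW kx]; apply/fset0Pn; exists x; rewrite !inE kx eqxx andbT.
have [x + xb] := eb F FW F0; rewrite !inE => /andP[xW /eqP kx].
have m0 : 0 < m by rewrite (leq_trans kx1)// km.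
(* Neighbours in [F] have [k = m] and the others at most [m.-1]; the burning inequality at [x]
   bounds the number of the former by [eta x]. *)
have lapx : lap k x <= deg adj x * m.-1 + eta x.
  apply: (@leq_trans (\sum_(y <- nbr adj x `&` W) (m.-1 + (y \in F)))).
    rewrite /lap big_seq [leqRHS]big_seq; apply: leq_sum => y; rewrite !inE => /andP[_ yW].
    rewrite yW /=; have := km y yW; rewrite leq_eqVlt => /orP[/eqP->|ylt].
      by rewrite eqxx; lia.
    by rewrite (leq_trans _ (leq_addr _ _))//; lia.
  rewrite big_split /= big_const_seq count_predT iter_addn_0 mulnC; apply: leq_add.
    by rewrite leq_mul2r fsubset_leq_card ?fsubsetIl// orbT.
  apply: leq_trans xb; rewrite add0n.
  rewrite -big_mkcond /= sum1_count -size_filter.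
  apply: uniq_leq_size; first by rewrite filter_uniq// fset_uniq.
  by move=> y; rewrite mem_filter !inE => /andP[/andP[-> ->] /andP[-> _]].
have xle : deg adj x <= lift eta k x.
  by rewrite /lift xW kx; nia.
pose k' z := k z - (z == x).
have k'E z : k z = k' z + (z == x).
  by rewrite /k' subnK//; case: eqVneq => // ->; rewrite kx.
have lapk' z : lap k z = lap k' z + adj z x.
  by rewrite -(lap1 _ xW) -lapD; apply: lap_ext => t _; rewrite k'E.
apply: (@fpath_cons _ _ _ (lift eta k')).
  exists x; split=> //; split=> //; apply/funext => z; rewrite /topple.
  case: eqVneq => [->|zx].
    by rewrite /lift xW lapk' adj_irr k'E eqxx; nia.
  rewrite /lift; case: ifP => //= zW.
  have := kge z zW; rewrite lapk' k'E (negbTE zx) addn0 (adjC x z).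
  by case: (adj z x); lia.
apply: IH => [|z zW].
  move: kn; rewrite (big_fsetD1 x)//= [in X in _ -> X](big_fsetD1 x)//=.
  rewrite (@eq_big_seq _ _ _ _ _ k k').
    by move: (k'E x); rewrite eqxx; set b := \sum_(_ <- _) _; lia.
  by move=> z; rewrite !inE k'E => /andP[/negbTE-> _]; rewrite addn0.
have := kge z zW; rewrite lapk' k'E; case: eqVneq => [->|_]; last by nia.
by move=> _; move: lapx; rewrite lapk' /k' eqxx kx adj_irr; nia.
Qed.

(** Both directions pass through [max_conf], which every stable configuration can reach. It is
    burnable and the chain preserves this. Conversely, raising [max_conf] to [lift eta k] and
    stabilizing leads to any burnable stable [eta]. *)
Theorem recurrentP eta :
  recurrent adj W eta <-> confs W (nbr adj) (fun=> 0) eta.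
Proof.
split=> [[es er]|[eta0 elt eb]].
  split; [exact: es.2|exact: es.1|].
  apply: chain_burnable max_conf_burnable; apply: er; exact: max_conf_reach.
have es : stable_conf adj W eta by split.
split=> // xi exi; apply: (@fpath_trans _ _ _ max_conf).
  apply: max_conf_reach; apply: fpath_preserve exi es => a b [x [xW [_ bs]]] _.
  exact: bs.
have [k k_sup] := superharmonic.
apply: (@add_chain _ (fun z => lift eta k z - max_conf z)) => //.
- exact: max_conf_stable.
- by move=> z zW; rewrite /lift (negbTE zW).
rewrite (_ : (fun z => _) = lift eta k).
  by apply: lift_topple => // x /k_sup; lia.
apply/funext => z; rewrite subnKC// /max_conf /lift; case: ifP => // zW.
by have := k_sup z zW; lia.
Qed.

End Dhar.

(** * Spanning trees as parent functions, and the unburnt set *)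

Lemma count_image (T T' : choiceType) (A : set T) (B : set T') (h : T -> T') :
  finite_set A -> {in A &, injective h} -> (forall a, A a -> B (h a)) ->
  (forall b, B b -> exists2 a, A a & h a = b) ->
  count_set A = count_set B.
Proof.
move=> finA h_inj AB BA; have -> : B = (h @` A)%classic.
  by apply/seteqP; split=> [b /BA[a Aa <-]|_ [a Aa <-]]; [exists a|exact: AB].
rewrite /count_set fset_set_image// card_in_imfset//= => a b.
by rewrite !in_fset_set// => Aa Ab; apply: h_inj.
Qed.

Lemma count_finset (T : finType) (A : {set T}) : count_set [set x | x \in A] = #|A|.
Proof.
rewrite -card_finset; congr #|` _|; apply/fsetP => x.
by rewrite !inE in_fset_set; [apply/idP/idP; rewrite ?inE|exact: finite_finset].
Qed.

Lemma count_disjoint (T I : choiceType) (A : set T) (N : I -> set T) (s : seq I) :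
  finite_set A -> uniq s ->
  (forall x i j, A x -> i \in s -> j \in s -> N i x -> N j x -> i = j) ->
  count_set (A `&` [set x | exists2 i, i \in s & N i x])%classic =
  \sum_(i <- s) count_set (A `&` N i)%classic.
Proof.
move=> finA; elim: s => [_ _|i s IH /= /andP[si us] dis].
  rewrite big_nil (_ : _ `&` _ = set0)%classic ?count0//.
  by apply/seteqP; split=> // x [_ []].
rewrite big_cons -IH//; last first.
  by move=> x j k Ax js ks; apply: (dis x) => //; rewrite in_cons ?js ?ks orbT.
rewrite (@count_split _ _ (N i)); last by apply: sub_finite_set finA => x [].
congr (_ + _); congr count_set; apply/seteqP; split=> x.
- by move=> [[Ax _] Nx].
- by move=> [Ax Nx]; split=> //; split=> //; exists i; rewrite ?mem_head.
- move=> [[Ax [j + Nj]] Ni]; rewrite in_cons => /orP[/eqP ji|js].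
    by rewrite ji in Nj.
  by split=> //; exists j.
- move=> [Ax [j js Nj]]; split; first by split=> //; exists j; rewrite ?in_cons ?js ?orbT.
  move=> Ni; rewrite (dis x i j) ?js// in si; rewrite ?mem_head ?in_cons ?js ?orbT//.
Qed.

Section SpanningTrees.
Variables (V : choiceType) (adj : rel V).
Hypothesis adj_simple : simple_graph adj.
Hypothesis adj_lf : locally_finite adj.
Implicit Types (U F W Q : {fset V}) (f g : V -> V) (eta : V -> nat).

Local Notation nbrs := (nbr adj).

Definition edges U f (p : V * V) :=
  ((p.1 \in U) && (f p.1 == p.2)) || ((p.2 \in U) && (f p.2 == p.1)).

Lemma edgesC U f x y : edges U f (x, y) = edges U f (y, x).
Proof. by rewrite /edges orbC. Qed.

Lemma edges_parent U f x : x \in U -> edges U f (x, f x).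
Proof. by rewrite /edges /= => ->; rewrite eqxx. Qed.

Lemma in_wired_edges W x y :
  ((x, y) \in wired_edges adj W) = adj x y && ((x \in W) || (y \in W)).
Proof.
have fin : finite_set [set p | adj p.1 p.2 /\ (p.1 \in W \/ p.2 \in W)].
  apply: (@sub_finite_set _ _ [set` \bigcup_(x <- W) [fset (x, y) | y in nbrs x] `|`
                                  \bigcup_(x <- W) [fset (y, x) | y in nbrs x]]) => //.
  move=> [a b] /= [ab]; rewrite inE => -[aW|bW]; apply/orP; [left|right].
    apply/bigfcupP; exists a; rewrite ?aW//; apply/imfsetP; exists b => //=.
    by rewrite (in_nbr adj_lf).
  apply/bigfcupP; exists b; rewrite ?bW//; apply/imfsetP; exists a => //=.
  by rewrite (in_nbr adj_lf) adjC.
rewrite /wired_edges in_fset_set//; apply/idP/idP; rewrite inE /=.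
  by move=> [-> [] ->]; rewrite ?orbT.
by move=> /andP[-> /orP]; split.
Qed.

Lemma tree_acyclic U (r : V -> {fset V}) f x n :
  trees U r f -> x \in U -> iter n.+1 f x <> x.
Proof.
move=> [f_id _ f_ex] xU nx; have [i ix] := f_ex x.
have mul m : iter (m * n.+1) f x = x.
  by elim: m => // m IH; rewrite mulSn iterD IH.
have out m : iter (m + i) f x = iter i f x.
  by elim: m => // m IH; rewrite addSn /= IH f_id.
by move: ix; rewrite -(out (i * n)) -mulnSr mul xU.
Qed.

(** If [f x] differs from [g x], the edge from [x] to [f x] must be the parent edge of [f x] in [g].
    Induction along [f] towards the exit gives [f (f x) = g (f x) = x], a cycle of length two. *)
Lemma tree_agree U W (r r' : V -> {fset V}) f g : W `<=` U ->
  trees U r f -> trees W r' g -> (forall x, x \in W -> edges W g (x, f x)) ->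
  {in W, f =1 g}.
Proof.
move=> WU tf tg fg x xW; have [f_id f_r f_ex] := tf.
move: xW; apply: (@exits_ind _ U f (fun x => x \in W -> f x = g x)) (f_ex x).
  by move=> {}x xU /(fsubsetP WU); rewrite (negbTE xU).
move=> {}x xU IH xW; have := fg x xW; rewrite /edges /= xW /= => /orP[/eqP//|].
move=> /andP[fxW /eqP gfx]; have := IH fxW; rewrite gfx => ffx.
by case: (tree_acyclic (n := 1) tf xU).
Qed.

Lemma edges_inj U (r : V -> {fset V}) f g : trees U r f -> trees U r g ->
  edges U f = edges U g -> f = g.
Proof.
move=> tf tg fg; apply/funext => x; have [xU|xU] := boolP (x \in U).
  apply: (tree_agree (fsubset_refl U) tf tg) => // y yU.
  by rewrite -fg edges_parent.
by rewrite (let: And3 h _ _ := tf in h)// (let: And3 h _ _ := tg in h).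
Qed.

Lemma collapse_in W x : x \in W -> collapse W x = Some x.
Proof. by rewrite /collapse => ->. Qed.

Lemma collapse_out W x : x \notin W -> collapse W x = None.
Proof. by rewrite /collapse => /negbTE ->. Qed.

Lemma wired_conn_exits W f (T : set (V * V)) x :
  (forall x, x \in W -> T (x, f x)) -> exits W f x ->
  wired_conn W T (collapse W x) None.
Proof.
move=> Tf; move: x; apply: exits_ind => x xW.
  by rewrite collapse_out//; apply: fpath0.
by apply: fpath_cons; exists (x, f x); split; [exact: Tf|].
Qed.

Lemma edges_spanning_tree W f : trees W nbrs f ->
  wired_spanning_tree adj W [set p | edges W f p].
Proof.
move=> tf; have [f_id f_r f_ex] := tf; split=> [|]; last split; last split.
- move=> [x y]; rewrite /edges /= in_wired_edges => /orP[/andP[xW /eqP<-]|/andP[yW /eqP<-]].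
    by rewrite -(in_nbr adj_lf) f_r// xW.
  by rewrite (adjC adj_simple) -(in_nbr adj_lf) f_r// yW orbT.
- by move=> x y; rewrite /= edgesC.
- move=> x xW; rewrite -(collapse_in xW); apply: (@wired_conn_exits _ f) (f_ex x).
  by move=> y yW; exact: edges_parent.
(* The descendants of [x] form one side of the cut: every edge other than that from [x] to [f x]
   respects them, [x] belongs to them and [f x] does not. *)
pose desc x o := if o is Some y then exists i, iter i f y = x else False.
have key x : x \in W ->
    desc x (collapse W x) /\ ~ desc x (collapse W (f x)) /\
    forall a b, (exists e, ([set p | edges W f p] `\` [set (x, f x); (f x, x)])%classic e /\
        collapse W e.1 = a /\ collapse W e.2 = b) -> desc x a <-> desc x b.
  move=> xW; split; first by rewrite collapse_in//; exists 0.
  split.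
    have [fxW|fxW] := boolP (f x \in W); last by rewrite collapse_out.
    rewrite collapse_in// => -[i] ix; apply: (tree_acyclic (n := i) tf xW).
    by rewrite iterSr.
  have child a b : a \in W -> a != x -> f a = b -> desc x (collapse W a) <-> desc x (collapse W b).
    move=> aW ax <-; rewrite collapse_in//.
    have [faW|faW] := boolP (f a \in W); last first.
      rewrite collapse_out//; split=> // -[[/=|i]]; first by move/eqP: ax.
      rewrite iterSr => ix; suff E m : iter m f (f a) = f a by rewrite -ix E (negbTE faW) in xW.
      by elim: m => //= m ->; apply: f_id.
    rewrite collapse_in//; split=> -[i].
      by case: i => [/= /eqP|i]; [rewrite (negbTE ax)|rewrite iterSr; exists i].
    by move=> ix; exists i.+1; rewrite iterSr.
  move=> a b [[u v] [[/= + ne] [<- <-]]]; rewrite /edges /=.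
  move=> /orP[/andP[uW /eqP fu]|/andP[vW /eqP fv]].
    by apply: child => //; apply: contra_notN ne => /eqP <-; left; rewrite fu.
  by apply: iff_sym; apply: child => //; apply: contra_notN ne => /eqP <-; right; rewrite fv.
move=> [a b]; rewrite /= /edges /= => /orP[/andP[aW /eqP<-]|/andP[bW /eqP<-]] path.
  have [Dx [nDx step]] := key a aW; apply: nDx.
  by apply: (@fpath_preserve _ _ (desc a) _ _ _ path Dx) => u v /step[].
have [Dx [nDx step]] := key b bW; rewrite setUC in step.
apply: (@fpath_preserve _ _ (fun o => ~ desc b o) _ _ _ path nDx) Dx => u v /step uv.
exact: contra_not uv.2.
Qed.

(** The parent of [x] is the second vertex of a shortest path to the sink. Any further edge of [T]
    could be removed without disconnecting its endpoints, since both still reach the sink along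
    parents; this contradicts acyclicity. *)
Lemma spanning_tree_edges W (T : set (V * V)) : wired_spanning_tree adj W T ->
  exists2 f, trees W nbrs f & T = [set p | edges W f p].
Proof.
move=> [T_sub [T_sym [T_conn T_acyc]]].
pose st (a b : option V) := exists e, T e /\ collapse W e.1 = a /\ collapse W e.2 = b.
pose dist x n := `[< nsteps st n (collapse W x) None >].
have dist_ex x : exists n, dist x n.
  have [xW|xW] := boolP (x \in W).
    have /fpath_betweenP[n pn] := T_conn x xW; exists n; apply/asboolP.
    by rewrite collapse_in.
  by exists 0; apply/asboolP; rewrite collapse_out.
pose d x := ex_minn (dist_ex x).
have /choice[f fP] : forall x, exists y, (x \notin W -> y = x) /\
    (x \in W -> T (x, y) /\ d y < d x).
  move=> x; have [xW|xW] := boolP (x \in W); last by exists x.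
  have : dist x (d x) by rewrite /d; case: ex_minnP.
  rewrite {1}/dist collapse_in//; case E : (d x) => [|m] /asboolP //=.
  move=> [q [[u y] [Tuy [/= ux <-]]] my]; exists y; split=> // _.
  have ux' : u = x by move: ux; rewrite /collapse; case: ifP => // _ [].
  rewrite -ux' ltnS; split=> //; rewrite /d; case: ex_minnP => k _; apply.
  exact/asboolP.
have fT x : x \in W -> T (x, f x) by move=> /(fP x).2[].
have tf : trees W nbrs f.
  split=> [x /(fP x).1//|x xW|x].
    have /T_sub := fT x xW; rewrite /= in_wired_edges => /andP[xf _].
    by rewrite (in_nbr adj_lf).
  have [n] := ubnP (d x); elim: n x => // n IH x dx.
  have [xW|xW] := boolP (x \in W); last exact: exits_out.
  apply/exits_step/IH; have [_] := (fP x).2 xW; rewrite ltnS in dx => dfx.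
  exact: leq_trans dfx dx.
exists f => //; apply/seteqP; split=> [[a b] Tab|[a b]]; last first.
  by rewrite /edges /= => /orP[] /andP[xW /eqP <-]; [|apply: T_sym]; apply: fT.
apply/negPn/negP => nab; apply: (T_acyc _ Tab) => /=.
set T' := (_ `\` _)%classic.
have fT' x : x \in W -> T' (x, f x).
  move=> xW; split; first exact: fT.
  case=> /= E; apply: (negP nab); first by rewrite -E; exact: edges_parent.
  by rewrite edgesC -E; exact: edges_parent.
have to_sink x : wired_conn W T' (collapse W x) None.
  by have [_ _ f_ex] := tf; apply: wired_conn_exits fT' (f_ex x).
apply: (fpath_trans (to_sink a)).
apply: (@fpath_ind _ _ (fun o => wired_conn W T' None o) None) (to_sink b).
  exact: fpath0.
move=> u v [[x y] [[Txy nxy] [<- <-]]] conn.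
apply: (fpath_trans conn); apply: (fpath_cons _ (fpath0 _ _)).
exists (y, x); split=> //; split; first exact: T_sym.
by move=> yx; apply: nxy; case: yx => -[-> ->]; [right|left].
Qed.

Lemma count_ust W (P : set (V * V -> bool)) :
  #|[set S in ust_set adj W | `[< P (fun p => `[< Defs.tree_of S p >]) >]]| =
  count_set (trees W nbrs `&` [set f | P (edges W f)])%classic.
Proof.
have treeE f : trees W nbrs f ->
    Defs.tree_of [set e : wired_edges adj W | edges W f (val e)]%SET = [set p | edges W f p].
  move=> tf; apply/seteqP; split=> [p [e []]|p pf]; first by rewrite inE => ? <-.
  have pW : p \in wired_edges adj W by have [+ _] := edges_spanning_tree tf; apply.
  by exists [` pW]; rewrite inE.
rewrite -count_finset; symmetry.
apply: (@count_image _ _ _ _ (fun f => [set e : wired_edges adj W | edges W f (val e)]%SET)).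
- by apply: sub_finite_set (finite_trees W nbrs) => f [].
- move=> f g; rewrite !inE => -[tf _] [tg _] fg; apply: (edges_inj tf tg).
  have := treeE f tf; rewrite fg treeE// => E.
  have Ep p : (edges W f p : Prop) = edges W g p := congr1 (fun A : set _ => A p) (esym E).
  by apply/funext => p; apply/idP/idP => pE; [rewrite -Ep|rewrite Ep].
- move=> f [tf Pf]; rewrite /= !inE; apply/andP; split; apply/asboolP; rewrite treeE//.
    exact: edges_spanning_tree.
  by rewrite (_ : (fun p => _) = edges W f)//; apply/funext => p; apply/asboolP/idP.
- move=> S; rewrite /= !inE => /andP[/asboolP S_st /asboolP PS].
  have [f tf SE] := spanning_tree_edges S_st; exists f.
    split=> //=; rewrite (_ : edges W f = (fun p => `[< Defs.tree_of S p >]))//.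
    by apply/funext => p; rewrite SE; apply/idP/asboolP.
  apply/setP => e; rewrite inE; apply/idP/idP.
    have : Defs.tree_of S (val e) <-> edges W f (val e) by rewrite SE.
    by move=> [_ /[apply]] [e' [e'S /val_inj <-]].
  move=> eS; have : Defs.tree_of S (val e) by exists e.
  by rewrite SE.
Qed.

(* Two graphs cut out by [W]: in the inner one the vertices of [W] form the
   interior and only those of [Q] are joined to the sink; in the outer one [W]
   is deleted, and [offset W] counts the deleted edges, which still contribute
   to the degrees of the sandpile. *)
Definition inner_nbrs Q W x := if x \in Q then nbrs x else nbrs x `&` W.
Definition outer_nbrs W x := nbrs x `\` W.
Definition offset W x := #|` nbrs x `&` W|.

(** Fixing the edges that touch [W] fixes the parents inside [W] and forbids parents in [W] from
    outside; the rest of [f] is then left free as a tree of the outer graph. *)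
Lemma glue_edges U W Q f g : W `<=` U -> trees W (inner_nbrs Q W) g ->
  trees U nbrs f ->
  (forall p, p \in wired_edges adj W -> edges U f p = edges W g p) <->
  {in W, f =1 g} /\ (forall x, x \in U -> x \notin W -> f x \notin W).
Proof.
move=> WU tg tf; have [f_id f_r f_ex] := tf; split=> [fg|[fg fW] [x y]].
  have fgW : {in W, f =1 g}.
    apply: (tree_agree WU tf tg) => x xW; rewrite -fg ?edges_parent ?(fsubsetP WU)//.
    by rewrite in_wired_edges xW andbT -(in_nbr adj_lf) f_r// (fsubsetP WU).
  split=> // x xU xW; apply/negP => fxW.
  have := fg (x, f x); rewrite in_wired_edges fxW orbT andbT -(in_nbr adj_lf) f_r//.
  move=> /(_ isT); rewrite edges_parent// /edges /= (negbTE xW) fxW /= -fgW//.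
  by move=> /esym/eqP ffx; case: (tree_acyclic (n := 1) tf xU).
rewrite in_wired_edges => /andP[_ xyW]; rewrite /edges /=.
suff H a b : (a \in W) || (b \in W) ->
    (a \in U) && (f a == b) = (a \in W) && (g a == b).
  by rewrite (H x y)// (H y x)// orbC.
have [aW _|aW /= bW] := boolP (a \in W); first by rewrite fg// (fsubsetP WU).
by apply/negP => /andP[aU /eqP fab]; have := fW a aU aW; rewrite fab bW.
Qed.

(** The right-hand side does not involve [g]. A glued map exits because it never enters [W] from
    outside, while [g] leads out of [W]. *)
Lemma count_glued U W Q g : W `<=` U -> trees W (inner_nbrs Q W) g ->
  count_set (trees U nbrs `&` [set f | forall p, p \in wired_edges adj W ->
     edges U f p = edges W g p])%classic =
  count_set (trees (U `\` W) (outer_nbrs W)).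
Proof.
move=> WU tg; have [g_id g_r g_ex] := tg.
apply: (@count_bij _ _ _ _ (fun f x => if x \in W then x else f x)
                           (fun f x => if x \in W then g x else f x)).
- by apply: sub_finite_set (finite_trees U nbrs) => f [].
- move=> f [tf /(glue_edges WU tg tf)[fg fW]]; have [f_id f_r f_ex] := tf.
  split; last first.
    by apply/funext => x /=; case: ifP => xW; [rewrite fg|rewrite xW].
  split=> [x|x|x].
  + by rewrite !inE; case: (boolP (x \in W)) => //= _; apply: f_id.
  + rewrite inE => /andP[xW xU]; rewrite (negbTE xW) !inE fW//=.
    exact: f_r.
  + apply: exits_ind (f_ex x) => {}x xU.
      by apply: exits_out; rewrite inE (negbTE xU) andbF.
    have [xW _|xW fx] := boolP (x \in W); first by apply: exits_out; rewrite inE xW.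
    by apply: exits_step; rewrite (negbTE xW).
- move=> f tf; have [f_id f_r f_ex] := tf.
  have fW x : x \in U -> x \notin W -> f x \notin W.
    by move=> xU xW; have := f_r x; rewrite !inE xU xW => /(_ isT)/andP[].
  split; last first.
    by apply/funext => x /=; case: ifP => xW; [rewrite f_id// inE xW|rewrite xW].
  set h := fun x : V => if x \in W then g x else f x.
  have hW : {in W, h =1 g} by move=> x xW; rewrite /h xW.
  have th : trees U nbrs h.
    split=> [x xU|x xU|x].
    + have xW : x \notin W by apply: contra xU; apply: (fsubsetP WU).
      by rewrite /h (negbTE xW) f_id// inE (negbTE xU) andbF.
    + rewrite /h; case: ifP => [xW|/negbT xW].
        by have := g_r x xW; rewrite /inner_nbrs; case: ifP => // _; rewrite inE => /andP[].
      by have := f_r x; rewrite !inE xU xW => /(_ isT)/andP[].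
    + have out y : y \notin W -> exits U h y.
        apply: (@exits_ind _ _ _ (fun y => y \notin W -> exits U h y)) (f_ex y) => {}y.
          by rewrite inE negb_and negbK => /orP[-> //|yU _]; apply: exits_out.
        rewrite inE => /andP[yW yU] IH _; apply: exits_step; rewrite /h (negbTE yW).
        exact/IH/fW.
      apply: exits_ind (g_ex x) => // {}x xW gx; apply: exits_step.
      by rewrite /h xW.
  split=> //; apply/(glue_edges WU tg th); split=> // x xU xW.
  by rewrite /h (negbTE xW) fW.
Qed.

(* [W] is the set left when [eta] is burnt in [U] without burning [Q]. *)
Definition unburnt Q U W eta :=
  (forall x, x \in W -> x \notin Q -> eta x < #|` nbrs x `&` W|) /\
  burnable (U `\` W) (outer_nbrs W) (offset W) eta.

Lemma offsetE W F x : [disjoint F & W] ->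
  offset W x + #|` outer_nbrs W x `&` F| = #|` nbrs x `&` (F `|` W)|.
Proof.
move=> FW; rewrite /offset /outer_nbrs -(cardfsID W (nbrs x `&` (F `|` W))).
congr (_ + _); congr #|` _|; apply/fsetP => z; rewrite !inE.
  by do !case: (_ \in _).
have [zW|zW] := boolP (z \in W); last by rewrite orbF.
by rewrite /= ?andbF.
Qed.

(** If [W'] exceeded [W], burning the complement of [W] would burn some vertex of [W'] while the
    rest of [W'] is still present, although [W'] is stuck. *)
Lemma unburnt_sub Q U W W' eta : Q `<=` W -> W' `<=` U ->
  unburnt Q U W eta -> unburnt Q U W' eta -> W' `<=` W.
Proof.
move=> QW WU' [_ bW] [sW' _]; rewrite -fsetD_eq0; apply/negPn/negP => D0.
have [|x xD] := bW _ _ D0; first exact: fsetSD.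
rewrite offsetE; last by rewrite fdisjoint_sym; apply/fdisjointP => z zW; rewrite inE zW.
move: xD; rewrite inE => /andP[xW xW'] xb.
have xQ : x \notin Q by apply: contra xW; apply: (fsubsetP QW).
have := sW' x xW' xQ; rewrite ltnNge => /negP; apply; apply: leq_trans xb.
apply: fsubset_leq_card; apply: fsetIS; apply/fsubsetP => z zW'.
by rewrite !inE zW' andbT orNb.
Qed.

Lemma unburnt_uniq Q U W W' eta : Q `<=` W -> Q `<=` W' -> W `<=` U -> W' `<=` U ->
  unburnt Q U W eta -> unburnt Q U W' eta -> W = W'.
Proof.
move=> QW QW' WU WU' uW uW'; apply/eqP.
by rewrite eqEfsubset (unburnt_sub QW' WU uW' uW) (unburnt_sub QW WU' uW uW').
Qed.

Lemma nbrs_split W x : #|` nbrs x| = offset W x + #|` outer_nbrs W x|.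
Proof. by rewrite /offset /outer_nbrs cardfsID. Qed.

Lemma burnable_cong U r lo eta eta' : {in U, eta =1 eta'} ->
  burnable U r lo eta -> burnable U r lo eta'.
Proof.
move=> ee eb F FU F0; have [x xF xb] := eb F FU F0; exists x => //.
by rewrite -ee// (fsubsetP FU).
Qed.

(** The domain Markov property of burning. In the inner graph the height bound off [Q] says that [W]
    is stuck, and on [Q] it is ordinary stability. The event [P] sees only [Q], so it goes to the
    inner factor. *)
Lemma count_unburnt Q U W (P : set (V -> nat)) : Q `<=` W -> W `<=` U ->
  (forall eta eta', {in Q, eta =1 eta'} -> P eta -> P eta') ->
  count_set ((confs U nbrs (fun=> 0) `&` P) `&` unburnt Q U W)%classic =
  count_set (confs (U `\` W) (outer_nbrs W) (offset W)) *
  count_set (confs W (inner_nbrs Q W) (fun=> 0) `&` P)%classic.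
Proof.
move=> QW WU PQ; rewrite -count_prod; last 2 first.
- exact: finite_confs.
- by apply: sub_finite_set (finite_confs W (inner_nbrs Q W) (fun=> 0)) => f [].
apply: (@count_bij _ _ _ _
  (fun eta => (fun x => if x \in W then 0 else eta x, fun x => if x \in W then eta x else 0))
  (fun e x => if x \in W then e.2 x else e.1 x)).
- by apply: sub_finite_set (finite_confs U nbrs (fun=> 0)) => f [[]].
- move=> eta [[[e0 elt eb] ea] [es eo]]; split; last first.
    by apply/funext => x /=; case: ifP => xW; rewrite xW.
  split; split=> /=.
  + by move=> x; rewrite inE; case: (boolP (x \in W)) => //= _; apply: e0.
  + by move=> x; rewrite inE => /andP[/negbTE-> xU]; rewrite -nbrs_split elt.
  + apply: burnable_cong eo => x; by rewrite inE => /andP[/negbTE->].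
  + split.
    * by move=> x /negbTE->.
    * move=> x xW; rewrite xW /inner_nbrs; case: ifP => xQ; first by rewrite elt ?(fsubsetP WU).
      by rewrite es// xQ.
    * move=> F FW F0; have [x xF xb] := eb F (fsubset_trans FW WU) F0; exists x => //.
      rewrite (fsubsetP FW _ xF); apply: leq_trans xb; rewrite /inner_nbrs; case: ifP => // _.
      by apply: fsubset_leq_card; apply: fsetSI; apply: fsubsetIl.
  + by apply: PQ ea => x xQ; rewrite (fsubsetP QW _ xQ).
- move=> [e1 e2] [[/= e0 elt eb] [[/= d0 dlt db] /= da]]; split; last first.
    congr pair; apply/funext => x /=; case: ifP => xW; rewrite ?xW//.
      by rewrite [RHS]e0// inE xW.
    by rewrite [RHS]d0// xW.
  have uo : burnable (U `\` W) (outer_nbrs W) (offset W)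
      (fun x => if x \in W then e2 x else e1 x).
    by apply: burnable_cong eb => x; rewrite inE => /andP[/negbTE->].
  split; last split=> //=.
  + split; last by apply: PQ da => x xQ; rewrite (fsubsetP QW _ xQ).
    split=> /=.
    * move=> x xU; rewrite (_ : x \in W = false) ?e0 ?inE ?(negbTE xU) ?andbF//.
      by apply: contraNF xU; apply: (fsubsetP WU).
    * move=> x xU; case: ifP => xW; last by have := elt x; rewrite inE xW xU -nbrs_split; apply.
      apply: leq_trans (dlt x xW) _; rewrite leq_add2l /inner_nbrs; case: ifP => // _.
      exact/fsubset_leq_card/fsubsetIl.
    (* A set inside [W] burns by the inner condition; otherwise its part outside [W] burns first,
       with all of [W] still present. *)
    * move=> F FU F0; have [FW|FW] := boolP (F `<=` W).
        have [x xF xb] := db F FW F0; exists x => //; rewrite (fsubsetP FW _ xF).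
        apply: leq_trans xb; rewrite /inner_nbrs; case: ifP => // _.
        apply: fsubset_leq_card; apply/fsubsetP => z; rewrite !inE => /andP[-> zF].
        by rewrite zF (fsubsetP FW).
      have [||x + xb] := uo (F `\` W); first exact: fsetSD.
        by rewrite fsetD_eq0.
      rewrite inE => /andP[xW xF]; exists x => //; apply: leq_trans xb.
      rewrite offsetE; last by rewrite fdisjoint_sym; apply/fdisjointP => z zW; rewrite inE zW.
      apply: fsubset_leq_card; apply: fsetIS; apply/fsubsetP => z zF.
      by rewrite !inE zF andbT orNb.
  + move=> x xW xQ; rewrite xW; have := dlt x xW; rewrite /inner_nbrs (negbTE xQ).
    by rewrite add0n.
Qed.

End SpanningTrees.

(** * Descendants, balls and long paths *)

(* Compactness via a free ultrafilter on [nat]. *)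
Lemma koenig (T : choiceType) (K : nat -> {fset T}) (z : nat -> nat -> T) :
  (forall k j, j <= k -> z k j \in K j) ->
  exists p : nat -> T, forall m, exists2 k, m <= k & forall j, j <= m -> z k j = p j.
Proof.
move=> zK; have [G [GU sFG]] := @ultraFilterLemma nat \oo _.
have GF : ProperFilter G by exact: ultra_proper.
have /choice[p pG] : forall j, exists t, G [set k | z k j = t].
  move=> j; apply: contrapT => noP.
  have notG t : G (~` [set k | z k j = t])%classic.
    by have [] := in_ultra_setVsetC [set k | z k j = t] GU => // Gt; case: noP; exists t.
  have G1 : G [set k | j <= k] by apply: sFG; exists j.
  have G2 : G [set k | z k j \notin K j].
    (* If no single value is [G]-frequent, finitely many values can be excluded together, and [K j]
       is finite. *)
    suff H (s : seq T) : G [set k | z k j \notin s] by exact: H.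
    elim: s => [|t s IH]; first by apply: filterS filterT.
    apply: filterS (filterI (notG t) IH) => k [zt zs]; rewrite /= in_cons negb_or.
    by apply/andP; split=> //; apply/eqP.
  have [k [jk]] := filter_ex (filterI G1 G2).
  by rewrite /= zK.
exists p => m; have Gm n : G [set k | forall j, j < n -> z k j = p j].
  elim: n => [|n IH]; first by apply: filterS filterT.
  apply: filterS (filterI (pG n) IH) => k [zn zs] j /=.
  by rewrite ltnS leq_eqVlt => /orP[/eqP->//|/zs].
have G1 : G [set k | m <= k] by apply: sFG; exists m.
have [k [mk zk]] := filter_ex (filterI G1 (Gm m.+1)).
by exists k.
Qed.

Section Balls.
Variables (V : choiceType) (adj : rel V).
Hypothesis adj_simple : simple_graph adj.
Hypothesis adj_lf : locally_finite adj.
Hypothesis adj_conn : connected_graph adj.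
Implicit Types (U F W Q : {fset V}) (f g : V -> V) (eta : V -> nat).

Local Notation nbrs := (nbr adj).

Fixpoint gball Q k := if k is k'.+1 then gball Q k' `|` \bigcup_(x <- gball Q k') nbrs x else Q.

Lemma gball_le Q j k : j <= k -> gball Q j `<=` gball Q k.
Proof.
move=> /subnK <-; elim: (k - j) => [|m IH]; first exact: fsubset_refl.
by rewrite addSn; apply: fsubset_trans IH _; apply: fsubsetUl.
Qed.

Lemma gball_adj Q k x y : x \in gball Q k -> adj x y -> y \in gball Q k.+1.
Proof.
move=> xk xy; rewrite /= inE; apply/orP; right; apply/bigfcupP; exists x; rewrite ?xk//.
by rewrite (in_nbr adj_lf).
Qed.

Lemma gball_path Q (p : nat -> V) m : p 0 \in Q ->
  (forall j, j < m -> adj (p j) (p j.+1)) -> forall j, j <= m -> p j \in gball Q j.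
Proof.
move=> p0 ps; elim=> // j IH jm; apply: (gball_adj (x := p j)); last exact: ps.
exact/IH/ltnW.
Qed.

Lemma gball_cover Q x : Q != fset0 -> exists k, x \in gball Q k.
Proof.
move=> /fset0Pn[q qQ]; have [n [p [p0 [<- ps]]]] := adj_conn q x.
by exists n; apply: (gball_path (p := p) (m := n)); rewrite ?p0.
Qed.


(* [W] is the set of descendants of [Q]; a descendant outside the ball of
   radius [k] yields a simple path of length [2k] centered at [Q]. *)
Lemma core_or_path Q U f k : gball Q k `<=` U -> trees U nbrs f ->
  (exists W g, [/\ Q `<=` W, W `<=` gball Q k, trees W (inner_nbrs adj Q W) g &
     forall p, p \in wired_edges adj W -> edges U f p = edges W g p]) \/
  (exists z : nat -> V, [/\ z k \in Q,
     forall j, j < k + k -> adj (z j) (z j.+1) && edges U f (z j, z j.+1) &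
     forall i j, i <= k + k -> j <= k + k -> z i = z j -> i = j]).
Proof.
move=> BU tf; have [f_id f_r f_ex] := tf.
have QB : Q `<=` gball Q k by exact: (@gball_le Q 0).
have QU := fsubset_trans QB BU.
pose W := [fset x in U | `[< exists i, iter i f x \in Q >]].
have WU : W `<=` U by apply/fsubsetP => x; rewrite !inE => /andP[].
have WP x : (x \in W) <-> exists i, iter i f x \in Q.
  rewrite !inE; split=> [/andP[_ /asboolP]//|[i ix]].
  have xU : x \in U.
    apply/negPn/negP => xU; have E m : iter m f x = x.
      by elim: m => //= m ->; rewrite f_id.
    by move: ix; rewrite E => /(fsubsetP QU); apply/negP.
  by rewrite xU; apply/asboolP; exists i.
have QW : Q `<=` W by apply/fsubsetP => x xQ; apply/WP; exists 0.
have WS x : x \notin Q -> x \in W -> f x \in W.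
  move=> xQ /WP[[|i] /=]; first by move=> xQ'; rewrite xQ' in xQ.
  by rewrite -iterS iterSr => ix; apply/WP; exists i.
have WV x : f x \in W -> x \in W.
  by move=> /WP[i ix]; apply/WP; exists i.+1; rewrite iterSr.
have [WB|/fsubsetPn[x xW xB]] := boolP (W `<=` gball Q k); [left|right].
  pose g x := if x \in W then f x else x.
  have tg : trees W (inner_nbrs adj Q W) g.
    split=> [x /negbTE xW|x xW|x]; first by rewrite /g xW.
      rewrite /g xW /inner_nbrs; have xU := fsubsetP WU _ xW.
      by case: (boolP (x \in Q)) => xQ; [exact: f_r|rewrite inE f_r//= WS].
    apply: exits_ind (f_ex x) => {}x xU.
      by apply: exits_out; apply: contra xU; apply: (fsubsetP WU).
    have [xW gx|xW _] := boolP (x \in W); last exact: exits_out.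
    by apply: exits_step; rewrite /g xW.
  exists W, g; split=> //; apply/(glue_edges adj_simple adj_lf WU tg tf); split.
    by move=> x xW; rewrite /g xW.
  by move=> x xU; apply: contra => /WV.
have [i ix] := (WP x).1 xW.
have xiU j : j <= i -> iter j f x \in U.
  move=> ji; apply: (fsubsetP WU); apply/WP; exists (i - j).
  by rewrite -iterD subnK.
have adjU y : y \in U -> adj y (f y).
  by move=> yU; rewrite -(in_nbr adj_lf) f_r.
(* The [i] steps from [x] to [Q] are steps along edges, and [x] is outside the ball. *)
have ki : k < i.
  rewrite ltnNge; apply: contra xB => ik; apply: (fsubsetP (gball_le Q ik)).
  rewrite -[x]/(iter 0 f x) -(subnn i).
  apply: (gball_path (p := fun j => iter (i - j) f x) (m := i)) => //.
    by rewrite subn0.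
  move=> j ji; rewrite (adjC adj_simple).
  have -> : i - j = (i - j.+1).+1 by lia.
  by apply: adjU; apply: xiU; apply: leq_subr.
(* A window centred at a visit to [Q]: its first half consists of descendants and its second half
   stays in the ball, so all of it lies in [U], where [f] has no cycle. *)
pose z j := iter (i - k + j) f x.
have zS j : z j.+1 = f (z j) by rewrite /z addnS.
have zk : z k \in Q by rewrite /z subnK// ltnW.
have zB m : m <= k -> z (k + m) \in gball Q m.
  elim: m => [|m IH] mk; first by rewrite addn0.
  rewrite addnS zS; have zm := IH (ltnW mk); apply: (gball_adj zm); apply: adjU.
  by apply: (fsubsetP BU); apply: (fsubsetP (gball_le Q (ltnW mk))).
have zU j : j <= k + k -> z j \in U.
  move=> jk; have [jk'|kj] := leqP j k; first by apply: xiU; lia.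
  have -> : j = k + (j - k) by lia.
  by apply: (fsubsetP BU); apply: (fsubsetP (@gball_le Q (j - k) k _)); [lia|apply: zB; lia].
have zinj a b : a < b -> b <= k + k -> z a <> z b.
  move=> ab bk; have -> : z b = iter (b - a.+1).+1 f (z a).
    by rewrite /z -iterD; congr iter; lia.
  by move=> /esym; apply: (tree_acyclic tf); apply: zU; lia.
exists z; split=> // [j jk|a b ak bk zab].
  by rewrite zS adjU ?edges_parent ?zU// ltnW.
by have [ab|ba|//] := ltngtP a b; [case: (zinj a b ab bk)|case: (zinj b a ba ak)].
Qed.

(** Cut each path at its centre and apply [koenig] to the pairs of half-paths. The limit is a pair
    of infinite paths in one component which meet only at their common start. *)
Lemma long_paths_not_one_ended Q (w : V * V -> bool) :
  (forall k, exists z : nat -> V, [/\ z k \in Q,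
     forall j, j < k + k -> [/\ adj (z j) (z j.+1), w (z j, z j.+1) & w (z j.+1, z j)] &
     forall i j, i <= k + k -> j <= k + k -> z i = z j -> i = j]) ->
  ~ one_ended_components adj w.
Proof.
move=> /choice[z zP] oe.
pose u k j := (z k (k + j), z k (k - j)).
have uK k j : j <= k -> u k j \in gball Q j `*` gball Q j.
  have [zQ zw _] := zP k; move=> jk; rewrite inE /=; apply/andP; split.
    apply: (gball_path (p := fun j => z k (k + j)) (m := k)) => //; first by rewrite addn0.
    by move=> m mk; rewrite addnS; have [] := zw (k + m) => //; lia.
  apply: (gball_path (p := fun j => z k (k - j)) (m := k)) => //; first by rewrite subn0.
  move=> m mk; have [] := zw (k - m.+1); first lia.
  by rewrite (_ : (k - m.+1).+1 = k - m); [rewrite (adjC adj_simple)|lia].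
have [p pP] := koenig uK.
have pE m : exists k, [/\ m <= k, forall j, j <= m -> z k (k + j) = (p j).1 &
    forall j, j <= m -> z k (k - j) = (p j).2].
  by have [k mk E] := pP m; exists k; split=> // j /E <-.
apply: (oe (fun j => (p j).1) (fun j => (p j).2)).
- move=> i; have [k [ik E _]] := pE i.+1; rewrite -!E ?leqnSn//.
  have [_ zw _] := zP k; have [|zz ww _] := zw (k + i); first lia.
  by rewrite addnS zz ww.
- move=> i j pij; have [k [mk E _]] := pE (i + j); have [_ _ zi] := zP k.
  by move: pij; rewrite -!E; [move/zi; lia|lia|lia].
- move=> i; have [k [ik _ E]] := pE i.+1; rewrite -!E ?leqnSn//.
  have [_ zw _] := zP k; have [|zz _ ww] := zw (k - i.+1); first lia.
  by move: zz ww; rewrite (_ : (k - i.+1).+1 = k - i); [rewrite (adjC adj_simple) => -> ->|lia].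
- move=> i j pij; have [k [mk _ E]] := pE (i + j); have [_ _ zi] := zP k.
  by move: pij; rewrite -!E; [move/zi; lia|lia|lia].
- have [k [_ E1 E2]] := pE 0; rewrite -E1// -E2// addn0 subn0; exact: fpath0.
apply: (@sub_finite_set _ _ [set (p 0).1]); last exact: finite_set1.
move=> v [[i <-] [j pij]] /=; have [k [mk E1 E2]] := pE (i + j); have [_ _ zi] := zP k.
move: pij; rewrite -E1 -?E2; [move/zi => H|lia|lia].
suff -> : i = 0 by rewrite E1.
by have := H _ _; lia.
Qed.

End Balls.

(** * Recurrent configurations as burnable height functions *)

Section SandpileCount.
Variables (V : choiceType) (adj : rel V).
Hypothesis adj_simple : simple_graph adj.
Hypothesis adj_lf : locally_finite adj.
Hypothesis adj_conn : connected_graph adj.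
Variables (W : {fset V}) (v0 : V).
Hypothesis v0W : v0 \notin W.

Lemma count_sandpile (P : set (V -> nat)) :
  #|[set c in recurrent_set adj W | `[< P (conf_of c) >]]| =
  count_set (confs W (nbr adj) (fun=> 0) `&` P)%classic.
Proof.
rewrite -count_finset; apply: (@count_image _ _ _ _ (@conf_of V adj W)).
- exact: finite_finset.
- move=> c d _ _ cd; apply/ffunP => x; apply: val_inj.
  by have := congr1 (@^~ (val x)) cd; rewrite /conf_of valK.
- move=> c /=; rewrite !inE => /andP[/asboolP rc /asboolP Pc]; split=> //.
  exact/(recurrentP adj_simple adj_lf adj_conn v0W).
move=> eta [ce Pe]; have [e0 elt _] := ce.
have lt (x : W) : eta (val x) < deg adj (val x) by apply: elt; apply: valP.
have E : conf_of ([ffun x => Ordinal (lt x)] : stable_space adj W) = eta.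
  apply/funext => x; rewrite /conf_of; case: insubP => [y _ <-|/e0->//].
  by rewrite ffunE.
exists [ffun x => Ordinal (lt x)] => //=; rewrite !inE E; apply/andP; split; apply/asboolP => //.
exact/(recurrentP adj_simple adj_lf adj_conn v0W).
Qed.

End SandpileCount.

(** * Convergence of the cylinder probabilities *)

(** The limit is the supremum of [l], fixed before the sequence is given; this is what yields
    independence of the exhaustion. One sequence obeying the bounds is required so that [l] stays
    below every [l k + dl k]. *)
Lemma squeeze_family (R : realType) (l dl : nat -> R) :
  let approx (x : nat -> R) := forall k e, (0 < e)%R ->
    \forall n \near \oo, (l k - e <= x n <= l k + dl k + e)%R in
  (forall e, (0 < e)%R -> exists k, (dl k < e)%R) -> (exists x, approx x) ->
  exists L : R, forall x, approx x -> x @ \oo --> L.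
Proof.
move=> approx dl0 [x0 x0P].
have ll k k' : (l k <= l k' + dl k')%R.
  apply/ler_addgt0Pr => e e0; have e2 : (0 < e / 2)%R by rewrite divr_gt0.
  have [n [/andP[h1 _] /andP[_ h2]]] := filter_ex (filterI (x0P k _ e2) (x0P k' _ e2)).
  by move: h1 h2; lra.
have ubl k : ubound (range l) (l k + dl k)%R by move=> _ [j _ <-].
have supl : has_sup (range l) by split; [exists (l 0), 0|exists (l 0 + dl 0)%R].
exists (sup (range l)) => x xP; apply/cvgrPdist_le => e e0.
have e3 : (0 < e / 3)%R by rewrite divr_gt0.
have [k dk] := dl0 _ e3.
have l1 : (l k <= sup (range l))%R by apply: sup_upper_bound => //; exists k.
have l2 : (sup (range l) <= l k + dl k)%R by apply: sup_le_ub => //; exists (l 0), 0.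
apply: filterS (xP k _ e3) => n /andP[h1 h2].
by rewrite ler_norml; apply/andP; split; lra.
Qed.

Lemma le_measure_seq d (T : measurableType d) (R : realType)
    (mu : ({measure set T -> \bar R})%R) (I : eqType) (s : seq I) (A : I -> set T) :
  (forall i, i \in s -> measurable (A i)) ->
  measurable [set x | exists2 i, i \in s & A i x] /\
  (mu [set x | exists2 i, i \in s & A i x] <= \sum_(i <- s) mu (A i))%E.
Proof.
elim: s => [|i s IH] mA.
  rewrite (_ : [set x | _] = set0); last by apply/seteqP; split=> // x [].
  by rewrite measure0 big_nil.
have [|mB muB] := IH; first by move=> j js; apply: mA; rewrite in_cons js orbT.
rewrite (_ : [set x | exists2 j, j \in i :: s & A j x] =
  (A i `|` [set x | exists2 i, i \in s & A i x])%classic); last first.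
  apply/seteqP; split=> x.
    by move=> [j]; rewrite in_cons => /orP[/eqP->|js] Aj; [left|right; exists j].
  by move=> [Ai|[j js Aj]]; [exists i; rewrite ?mem_head|exists j; rewrite ?in_cons ?js ?orbT].
have mAi : measurable (A i) by apply: mA; rewrite mem_head.
split; first exact: measurableU.
rewrite big_cons; apply: le_trans (measureU2 _ mAi mB) _.
exact: leeD2l.
Qed.

Lemma exhaustion_sub (V : choiceType) (Vn : nat -> {fset V}) (F : {fset V}) :
  is_exhaustion Vn -> \forall n \near \oo, F `<=` Vn n.
Proof.
move=> [Vmono Vcov].
have mono m n : m <= n -> Vn m `<=` Vn n.
  move=> /subnK <-; elim: (n - m) => [|i IH]; first exact: fsubset_refl.
  exact: fsubset_trans IH (Vmono _).
have H (s : seq V) : exists N, forall x, x \in s -> x \in Vn N.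
  elim: s => [|x s [N NP]]; first by exists 0.
  have [M MP] := Vcov x; exists (maxn M N) => y; rewrite in_cons => /orP[/eqP->|ys].
    exact: (fsubsetP (mono _ _ (leq_maxl _ _))).
  by apply: (fsubsetP (mono _ _ (leq_maxr M _))); apply: NP.
have [N NP] := H F; exists N => // n Nn; apply/fsubsetP => x /NP.
exact: (fsubsetP (mono _ _ Nn)).
Qed.

Lemma measurable_cyl (I : eqType) (T : pointedType) (s : seq I) (b : I -> T) :
  measurable ([set w | forall i, i \in s -> w i = b i] : set (cylType I T)).
Proof.
elim: s => [|i s IH].
  by rewrite [X in measurable X](_ : _ = setT)//; apply/seteqP; split.
rewrite [X in measurable X](_ : _ =
  ([set w : cylType I T | w i = b i] `&` [set w | forall i, i \in s -> w i = b i])%classic).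
  by apply: measurableI => //; apply: sub_sigma_algebra; exists i, (b i).
apply/seteqP; split=> w.
  move=> ws; split; first by apply: ws; rewrite mem_head.
  by move=> j js; apply: ws; rewrite in_cons js orbT.
by move=> [wi ws] j; rewrite in_cons => /orP[/eqP->|/ws].
Qed.

Section Limit.
Variables (R : realType) (V : choiceType) (adj : rel V).
Hypothesis adj_simple : simple_graph adj.
Hypothesis adj_lf : locally_finite adj.
Hypothesis adj_conn : connected_graph adj.
Hypothesis V_inf : infinite_graph V.
Implicit Types (U F W Q : {fset V}) (f g : V -> V) (eta : V -> nat).

Local Notation nbrs := (nbr adj).

Lemma outside U : exists v, v \notin U.
Proof.
apply: contrapT => noU; apply: V_inf; apply: (@sub_finite_set _ _ [set` U]) => //.
by move=> v _ /=; apply/negPn/negP => vU; apply: noU; exists v.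
Qed.

Lemma exhaustion_ex : exists Vn : nat -> {fset V}, is_exhaustion Vn.
Proof.
have [v0 _] := outside fset0.
exists (gball adj [fset v0]); split=> [n|x]; first exact: gball_le.
by apply: gball_cover => //; apply/fset0Pn; exists v0; rewrite inE.
Qed.

Definition n_trees U := count_set (trees U nbrs).
Definition n_outer U W := count_set (trees (U `\` W) (outer_nbrs adj W)).
Definition inner_trees Q W := trees W (inner_nbrs adj Q W).
Definition n_inner Q W P :=
  count_set (confs W (inner_nbrs adj Q W) (fun=> 0) `&` P)%classic.

Definition regions Q k := [fset W in fpowerset (gball adj Q k) | Q `<=` W].

Lemma regionsP Q k W : (W \in regions Q k) = (Q `<=` W) && (W `<=` gball adj Q k).
Proof. by rewrite !inE fpowersetE andbC. Qed.

Lemma n_inner_setT Q W : n_inner Q W setT = count_set (inner_trees Q W).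
Proof. by rewrite /n_inner setIT -count_trees. Qed.

Lemma count_regions Q U k (P : set (V -> nat)) : gball adj Q k `<=` U ->
  (forall eta eta', {in Q, eta =1 eta'} -> P eta -> P eta') ->
  count_set ((confs U nbrs (fun=> 0) `&` P) `&`
    [set eta | exists2 W, W \in enum_fset (regions Q k) & unburnt adj Q U W eta])%classic =
  \sum_(W <- regions Q k) n_outer U W * n_inner Q W P.
Proof.
move=> BU PQ; rewrite (count_disjoint (N := unburnt adj Q U)).
- apply: eq_big_seq => W; rewrite regionsP => /andP[QW WB].
  by rewrite count_unburnt// ?(fsubset_trans WB)// -count_trees.
- by apply: sub_finite_set (finite_confs U nbrs (fun=> 0)) => f [].
- exact: fset_uniq.
move=> eta W W' _; rewrite -![_ \in enum_fset _]/(_ \in regions Q k) !regionsP.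
move=> /andP[QW WB] /andP[QW' WB'].
by apply: unburnt_uniq => //; apply: fsubset_trans BU.
Qed.

Definition agrees Q (a : V -> nat) : set (V -> nat) :=
  [set eta | forall x, x \in Q -> eta x = a x].

(** Configurations with an unburnt set inside the ball are counted exactly; all others, whatever
    their values on [Q], form the error. The upper bound is written additively because subtraction
    on [nat] truncates. *)
Lemma count_sandwich Q U k a : gball adj Q k `<=` U ->
  \sum_(W <- regions Q k) n_outer U W * n_inner Q W (agrees Q a) <=
    count_set (confs U nbrs (fun=> 0) `&` agrees Q a)%classic /\
  count_set (confs U nbrs (fun=> 0) `&` agrees Q a)%classic +
    \sum_(W <- regions Q k) n_outer U W * count_set (inner_trees Q W) <=
  \sum_(W <- regions Q k) n_outer U W * n_inner Q W (agrees Q a) + n_trees U.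
Proof.
move=> BU.
pose N := [set eta | exists2 W, W \in enum_fset (regions Q k) & unburnt adj Q U W eta].
have aQ eta eta' : {in Q, eta =1 eta'} -> agrees Q a eta -> agrees Q a eta'.
  by move=> ee ea x xQ; rewrite -ee// ea.
have fc := finite_confs U nbrs (fun=> 0).
have fA : finite_set (confs U nbrs (fun=> 0) `&` agrees Q a)%classic.
  by apply: sub_finite_set fc => f [].
rewrite -(count_regions BU aQ) -/N; split.
  by apply: count_sub => // f [].
have -> : \sum_(W <- regions Q k) n_outer U W * count_set (inner_trees Q W) =
    count_set (confs U nbrs (fun=> 0) `&` N)%classic.
  rewrite -[confs U nbrs _ in RHS]setIT count_regions//.
  by apply: eq_bigr => W _; rewrite n_inner_setT.
rewrite /n_trees (count_trees U nbrs (fun=> 0)).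
rewrite (count_split N fA) [in leqRHS](count_split N fc).
rewrite -!addnA leq_add2l addnC leq_add2l; apply: count_sub.
  by apply: sub_finite_set fc => f [].
by move=> f [[fc' _] fN].
Qed.

Lemma card_recurrent U v : v \notin U -> #|recurrent_set adj U| = n_trees U.
Proof.
move=> vU; rewrite /n_trees (count_trees U nbrs (fun=> 0)).
rewrite -[confs U nbrs _]setIT -(count_sandpile adj_simple adj_lf adj_conn vU).
by apply: eq_card => c; rewrite [in RHS]inE asboolT// andbT.
Qed.

Definition outer_ratio U W : R := ((n_outer U W)%:R / (n_trees U)%:R)%R.

Lemma sandpile_sandwich Q U k a : gball adj Q k `<=` U -> 0 < n_trees U ->
  (\sum_(W <- regions Q k) outer_ratio U W * (n_inner Q W (agrees Q a))%:R <=
   sandpile_cyl R adj U Q a <=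
   \sum_(W <- regions Q k) outer_ratio U W * (n_inner Q W (agrees Q a))%:R +
   (1 - \sum_(W <- regions Q k) outer_ratio U W * (count_set (inner_trees Q W))%:R))%R.
Proof.
move=> BU t0; have [v vU] := outside U.
have [h1 h2] := count_sandwich a BU.
have tE := card_recurrent vU.
have sumE (n : {fset V} -> nat) :
    (\sum_(W <- regions Q k) outer_ratio U W * (n W)%:R)%R =
    ((\sum_(W <- regions Q k) n_outer U W * n W)%N%:R / (n_trees U)%:R)%R :> R.
  rewrite natr_sum big_distrl /=; apply: eq_bigr => W _.
  by rewrite natrM mulrAC.
have tR : (0 < (n_trees U)%:R :> R)%R by rewrite ltr0n.
rewrite !sumE /sandpile_cyl tE.
rewrite (count_sandpile adj_simple adj_lf adj_conn vU (agrees Q a)).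
rewrite ler_pM2r ?invr_gt0// ler_nat h1 /=.
rewrite -[X in (_ + (X - _))%R](@divff R (n_trees U)%:R) ?gt_eqF//.
rewrite -mulrBl -mulrDl ler_pM2r ?invr_gt0// addrA lerBrDr -!natrD ler_nat.
exact: h2.
Qed.

Lemma ust_cylE U (F : {fset V * V}) b :
  ust_cyl R adj U F b = ((count_set (trees U nbrs `&`
     [set f | forall p, p \in F -> edges U f p = b p])%classic)%:R / (n_trees U)%:R)%R.
Proof.
rewrite /ust_cyl (count_ust adj_simple adj_lf U [set c | forall p, p \in F -> c p = b p]).
congr (_ / _%:R)%R; rewrite /n_trees -[trees U nbrs]setIT.
rewrite -(count_ust adj_simple adj_lf U setT).
by apply: eq_card => S; rewrite [in RHS]inE asboolT// andbT.
Qed.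

Definition cyl W g : set (EConf V) :=
  [set w | forall p, p \in wired_edges adj W -> w p = edges W g p].

Variable mu : probability (EConf V) R.
Hypothesis mu_wsf : wsf_limit adj mu.

Lemma outer_ratio_cvg Vn Q W g : is_exhaustion Vn -> inner_trees Q W g ->
  (fun n => (outer_ratio (Vn n) W)%:E) @ \oo --> mu (cyl W g).
Proof.
move=> ex tg; apply: cvg_trans; last exact: (mu_wsf ex (F := wired_edges adj W) (b := edges W g)).
apply: near_eq_cvg; apply: filterS (exhaustion_sub W ex) => n Wn /=.
by rewrite ust_cylE (count_glued adj_simple adj_lf Wn tg).
Qed.

(** [xget] picks an arbitrary inner tree, with default [id] if there is none. All inner trees give
    the same value, as each cylinder has the limit of the same [outer_ratio] as its probability. *)
Definition cyl_prob Q W : R := fine (mu (cyl W (@xget (V -> V : choiceType) id (inner_trees Q W)))).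

Lemma cyl_probE Q W g : inner_trees Q W g -> mu (cyl W g) = (cyl_prob Q W)%:E.
Proof.
move=> tg; have [Vn ex] := exhaustion_ex.
have h1 := outer_ratio_cvg ex tg.
have h2 := outer_ratio_cvg ex (@xgetI (V -> V : choiceType) id _ g tg).
rewrite /cyl_prob fineK ?fin_num_measure//; last exact: measurable_cyl.
exact: (cvg_unique _ h1 h2).
Qed.

Lemma outer_ratio_cvgR Vn Q W : is_exhaustion Vn -> inner_trees Q W !=set0 ->
  (fun n => outer_ratio (Vn n) W) @ \oo --> cyl_prob Q W.
Proof.
move=> ex [g tg]; have := outer_ratio_cvg ex tg; rewrite (cyl_probE tg).
exact: fine_cvg.
Qed.

Lemma n_trees_gt0 Vn : is_exhaustion Vn -> \forall n \near \oo, 0 < n_trees (Vn n).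
Proof.
(* For the empty pattern [ust_cyl] is [n / n], which is 0 when there is no tree, whereas its limit
   is 1. *)
move=> ex; have := mu_wsf ex (F := fset0) (b := fun=> true).
rewrite [X in mu X](_ : _ = setT); last by apply/seteqP; split.
rewrite probability_setT => /fine_cvg /= /cvgrPdist_lt/(_ 1%R ltr01) near1.
apply: filterS near1 => n /=; rewrite ust_cylE lt0n; apply: contraTneq => ->.
by rewrite invr0 mulr0 subr0 normr1 ltxx.
Qed.

Definition uncovered Q k : set (EConf V) :=
  [set w | ~ exists2 W, W \in enum_fset (regions Q k) &
    exists2 g, g \in enum_fset (fset_set (inner_trees Q W)) & cyl W g w].

(** A union bound over regions and inner trees. It turns the gap of the sandwich into an event of
    the limiting forest. *)
Lemma uncovered_bound Q k : measurable (uncovered Q k) /\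
  ((1 - \sum_(W <- regions Q k) cyl_prob Q W * (count_set (inner_trees Q W))%:R)%:E
   <= mu (uncovered Q k))%E.
Proof.
pose A W : set (EConf V) :=
  [set w | exists2 g, g \in enum_fset (fset_set (inner_trees Q W)) & cyl W g w].
have AP W : measurable (A W) /\
    (mu (A W) <= (cyl_prob Q W * (count_set (inner_trees Q W))%:R)%:E)%E.
  have [|mA muA] := @le_measure_seq _ _ _ mu _ (fset_set (inner_trees Q W)) (cyl W).
    by move=> g _; exact: measurable_cyl.
  split=> //; apply: le_trans muA _.
  rewrite (@eq_big_seq _ _ _ _ _ _ (fun=> (cyl_prob Q W)%:E)); last first.
    move=> g; rewrite in_fset_set; last exact: finite_trees.
    by rewrite inE => /cyl_probE.
  by rewrite sumEFin big_const_seq count_predT iter_addr_0 mulr_natr.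
have [|mB muB] := @le_measure_seq _ _ _ mu _ (regions Q k) A.
  by move=> W _; exact: (AP W).1.
have -> : uncovered Q k = (~` [set x | exists2 W, W \in enum_fset (regions Q k) & A W x])%classic by [].
split; first exact: measurableC.
rewrite probability_setC//.
set B := [set x | _] in mB muB *.
have : (mu B <= (\sum_(W <- regions Q k)
    cyl_prob Q W * (count_set (inner_trees Q W))%:R)%:E)%E.
  apply: le_trans muB _; rewrite -sumEFin; apply: lee_sum => W _; exact: (AP W).2.
have : mu B \is a fin_num by apply: fin_num_measure.
case: (mu B) => // r _; rewrite lee_fin => rle.
by rewrite lee_fin lerB.
Qed.

Hypothesis one_ended : {ae mu, forall w, one_ended_components adj w}.

(** There are finitely many patterns on [F]. Hence almost every [w] shows only patterns of positive
    probability, which must occur in finite spanning trees. *)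
Lemma pattern_null (F : {fset V * V}) :
  mu.-negligible [set w : EConf V | mu [set w' : EConf V | forall p, p \in F -> w' p = w p] = 0%E].
Proof.
pose s := enum_fset (fpowerset F).
pose A (S : {fset V * V}) : set (EConf V) :=
  if mu [set w' : EConf V | forall p, p \in F -> w' p = (p \in S)] == 0%E
  then [set w' | forall p, p \in F -> w' p = (p \in S)] else set0.
have [|mA muA] := @le_measure_seq _ _ _ mu _ s A.
  by move=> S _; rewrite /A; case: ifP => // _; apply: measurable_cyl.
exists [set x | exists2 S, S \in s & A S x]; split=> //.
  apply/eqP; rewrite -measure_le0; apply: le_trans muA _.
  rewrite big1// => S _; rewrite /A; case: ifP => [/eqP//|_].
  exact: measure0.
move=> w /= w0; pose S := [fset p in F | w p].
have SE p : p \in F -> w p = (p \in S) by move=> pF; rewrite !inE pF.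
exists S.
  by rewrite -[_ \in s]/(_ \in fpowerset F) fpowersetE; apply/fsubsetP => p; rewrite !inE => /andP[].
rewrite /A ifT//; apply/eqP; rewrite -w0; congr (mu _).
by apply/seteqP; split=> w' w'E p pF; rewrite w'E// SE.
Qed.

(** Off a null set, the pattern of [w] around each ball occurs in a finite tree. By [core_or_path]
    that tree either covers [w] or has a long path through [Q] whose edges belong to the pattern,
    hence to [w]; long paths for every [k] contradict one-endedness. *)
Lemma uncovered_null Q : mu.-negligible (\bigcap_k uncovered Q k).
Proof.
have [Vn ex] := exhaustion_ex.
pose F k := wired_edges adj (gball adj Q k).
pose N := (\bigcup_k [set w : EConf V |
  mu [set w' : EConf V | forall p, p \in F k -> w' p = w p] = 0%E])%classic.
apply: (@negligibleS _ _ _ mu ([set w | ~ one_ended_components adj w] `|` N)%classic); last first.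
  apply: negligibleU => //; apply: negligible_bigcup => k; exact: pattern_null.
move=> w wU; have [wN|wN] := pselect (N w); [by right|left].
apply: (@long_paths_not_one_ended _ _ adj_simple adj_lf Q) => k.
have wk : ~ mu [set w' : EConf V | forall p, p \in F k -> w' p = w p] = 0%E.
  by move=> w0; apply: wN; exists k.
(* Otherwise [ust_cyl] vanishes on this pattern for all large [n], and so does its limit. *)
have [n [f [Bn tf fw]]] : exists n f, [/\ gball adj Q k `<=` Vn n, trees (Vn n) nbrs f &
    forall p, p \in F k -> edges (Vn n) f p = w p].
  apply: contrapT => nof; apply: wk.
  have c0 : (fun n => (ust_cyl R adj (Vn n) (F k) w)%:E) @ \oo --> 0%E.
    apply: cvg_near_cst; apply: filterS (exhaustion_sub (gball adj Q k) ex) => n Bn.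
    rewrite ust_cylE [X in count_set X](_ : _ = set0) ?count0 ?mul0r//.
    by apply/seteqP; split=> // f [tf fw]; apply: nof; exists n, f.
  exact: (cvg_unique _ (mu_wsf ex (F := F k) (b := w)) c0).
have [[W [g [QW WB tg Wg]]]|[z [zQ zw zi]]] := core_or_path adj_simple adj_lf Bn tf.
  case: (wU k) => //; exists W; first by rewrite -[_ \in enum_fset _]/(_ \in regions Q k) regionsP QW.
  exists g.
    rewrite -[_ \in enum_fset _]/(_ \in fset_set _) in_fset_set; last exact: finite_trees.
    by rewrite inE.
  move=> [x y] pW; rewrite -Wg// fw//; move: pW.
  rewrite !(in_wired_edges adj_simple adj_lf) => /andP[-> /=].
  by case/orP => /(fsubsetP WB) ->; rewrite ?orbT.
exists z; split=> // j jk; have /andP[zz ee] := zw j jk.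
have zB i : i <= k -> z (k - i) \in gball adj Q k /\ z (k + i) \in gball adj Q k.
  move=> ik; split; apply: (fsubsetP (gball_le adj Q ik)).
    apply: (@gball_path _ _ adj_lf _ (fun j => z (k - j)) k) => //; first by rewrite subn0.
    move=> m mk; rewrite (adjC adj_simple) (_ : k - m = (k - m.+1).+1); last lia.
    have mlt : k - m.+1 < k + k by lia.
    by have /andP[] := zw _ mlt.
  apply: (@gball_path _ _ adj_lf _ (fun j => z (k + j)) k) => //; first by rewrite addn0.
  move=> m mk; have mlt : k + m < k + k by lia.
  by rewrite addnS; have /andP[] := zw _ mlt.
have zjB : z j \in gball adj Q k.
  have [jk'|kj] := leqP j k.
    by have [+ _] := zB (k - j) (leq_subr _ _); rewrite subKn.
  by have [|_] := zB (j - k); [lia|rewrite subnKC// ltnW].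
split=> //; rewrite -fw; try by rewrite (in_wired_edges adj_simple adj_lf) ?zz ?zjB ?orbT.
- by [].
- by rewrite edgesC.
- by rewrite (in_wired_edges adj_simple adj_lf) (adjC adj_simple) zz zjB orbT.
Qed.

Lemma uncovered_small Q e : (0 < e)%R -> exists k,
  (1 - \sum_(W <- regions Q k) cyl_prob Q W * (count_set (inner_trees Q W))%:R < e)%R.
Proof.
move=> e0; have mU k := (uncovered_bound Q k).1.
have mI : measurable (\bigcap_k uncovered Q k)%classic by apply: bigcapT_measurable.
have c : mu \o uncovered Q @ \oo --> mu (\bigcap_k uncovered Q k)%classic.
  apply: nonincreasing_cvg_mu => //.
    by rewrite (le_lt_trans (probability_le1 mu (mU 0)))// ltry.
  move=> j k jk; apply/subsetPset => w wk [W Wj gW]; apply: wk; exists W => //.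
  move: Wj; rewrite -![_ \in enum_fset _]/(_ \in regions _ _) !regionsP => /andP[-> WB].
  exact: fsubset_trans WB (gball_le _ _ jk).
rewrite (measure_negligible mI (uncovered_null Q)) in c.
move/fine_cvg : c => /= /cvgrPdist_lt/(_ e e0)/filter_ex[k].
rewrite sub0r normrN => ke; exists k; apply: le_lt_trans (le_lt_trans (ler_norm _) ke).
rewrite -lee_fin fineK; last by apply: fin_num_measure.
exact: (uncovered_bound Q k).2.
Qed.

Theorem sandpile_limit Q a : exists L : R, forall Vn, is_exhaustion Vn ->
  (fun n => sandpile_cyl R adj (Vn n) Q a) @ \oo --> L.
Proof.
pose l k := (\sum_(W <- regions Q k) cyl_prob Q W * (n_inner Q W (agrees Q a))%:R)%R.
pose dl k := (1 - \sum_(W <- regions Q k) cyl_prob Q W * (count_set (inner_trees Q W))%:R)%R.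
have sum_cvg Vn k (m : {fset V} -> nat) : is_exhaustion Vn ->
    (forall W, m W <= count_set (inner_trees Q W)) ->
    (fun n => \sum_(W <- regions Q k) outer_ratio (Vn n) W * (m W)%:R)%R @ \oo -->
    (\sum_(W <- regions Q k) cyl_prob Q W * (m W)%:R)%R.
  move=> ex mle; apply: cvg_big => [|W _]; first exact: add_continuous.
  have [tW|tW] := pselect (inner_trees Q W !=set0).
    by apply: cvgM; [exact: outer_ratio_cvgR|exact: cvg_cst].
  (* Without inner trees [outer_ratio] need not converge, but its factor is then zero. *)
  have -> : m W = 0.
    apply/eqP; rewrite -leqn0; apply: leq_trans (mle W) _.
    rewrite (_ : inner_trees Q W = set0) ?count0//; apply/seteqP; split=> // g tg.
    by apply: tW; exists g.
  by rewrite mulr0; under eq_fun do rewrite mulr0; exact: cvg_cst.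
have in_le W : n_inner Q W (agrees Q a) <= count_set (inner_trees Q W).
  rewrite -n_inner_setT; apply: count_sub => [|f []//].
  by apply: sub_finite_set (finite_confs W (inner_nbrs adj Q W) (fun=> 0)) => f [].
have appr Vn : is_exhaustion Vn -> forall k e, (0 < e)%R ->
    \forall n \near \oo, (l k - e <= sandpile_cyl R adj (Vn n) Q a <= l k + dl k + e)%R.
  move=> ex k e e0; have e2 : (0 < e / 2)%R by rewrite divr_gt0.
  have /cvgrPdist_le/(_ _ e2) c1 := sum_cvg Vn k _ ex in_le.
  have /cvgrPdist_le/(_ _ e2) c2 := sum_cvg Vn k (fun W => count_set (inner_trees Q W)) ex (fun=> leqnn _).
  near=> n.
  have Bn : gball adj Q k `<=` Vn n by near: n; exact: exhaustion_sub.
  have tn : 0 < n_trees (Vn n) by near: n; exact: n_trees_gt0.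
  have /andP[] := sandpile_sandwich a Bn tn.
  have : (`|l k - \sum_(W <- regions Q k)
     outer_ratio (Vn n) W * (n_inner Q W (agrees Q a))%:R| <= e / 2)%R by near: n.
  have : (`|(1 - dl k) - \sum_(W <- regions Q k)
     outer_ratio (Vn n) W * (count_set (inner_trees Q W))%:R| <= e / 2)%R.
    by rewrite /dl subKr; near: n.
  move: (sandpile_cyl _ _ _ _ _) (\sum_(W <- _) _)%R (\sum_(W <- _) _)%R => x s1 s2.
  by rewrite !ler_norml => /andP[h1 h2] /andP[h3 h4] h5 h6; apply/andP; split; lra.
have [Vn ex] := exhaustion_ex.
have [|L LP] := @squeeze_family R l dl (uncovered_small Q).
  by exists (fun n => sandpile_cyl R adj (Vn n) Q a); exact: appr.
by exists L => Vn' ex'; apply: LP; apply: appr.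
Unshelve. all: by end_near.
Qed.

End Limit.

(** * Random sequences with prescribed cylinder probabilities *)

Section UnitInterval.
Variable R : realType.

Definition unit_prob : set (measurableTypeR R) -> \bar R :=
  mrestr (@lebesgue_measure R) (measurable_itv `[0, 1[%R).

HB.instance Definition _ := Measure.on unit_prob.

Lemma unit_prob_setT : unit_prob setT = 1%E.
Proof.
by rewrite /unit_prob /mrestr setTI lebesgue_measure_itv /= lte_fin ltr01 oppr0 adde0.
Qed.

HB.instance Definition _ := Measure_isProbability.Build _ _ _ unit_prob unit_prob_setT.

Lemma unit_prob_itv (a b : R) : (0 <= a)%R -> (a <= b)%R -> (b <= 1)%R ->
  unit_prob `[a, b[%classic = (b - a)%:E.
Proof.
move=> a0 ab b1; rewrite /unit_prob /mrestr setIidl.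
  rewrite lebesgue_measure_itv /= lte_fin; case: ltP => // ba.
  by rewrite (@le_anti _ _ a b) ?ab// subrr.
by move=> x; rewrite /= !in_itv /= => /andP[ax xb]; rewrite (le_trans a0 ax) (lt_le_trans xb).
Qed.

End UnitInterval.

(* The law of a random sequence with prescribed cylinder probabilities [p],
   realized on [0, 1[: the words of length [n] index a partition of [0, 1[
   into intervals [cell w] of length [p w], each partition refining the
   previous one. *)
Section RandomSequence.
Local Open Scope ring_scope.
Variables (R : realType) (D : nat) (p : seq nat -> R).
Hypothesis p_ge0 : forall w, 0 <= p w.
Hypothesis p_nil : p [::] = 1.
Hypothesis p_rcons : forall w, p w = \sum_(t < D) p (rcons w t).

(** The mass of the words that precede [w] lexicographically, grouped by the first position where
    they differ from [w]. *)
Definition left_end (w : seq nat) : R :=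
  \sum_(i < size w) \sum_(t < nth 0%N w i) p (rcons (take i w) t).

Definition cut (w : seq nat) (t : nat) : R := left_end w + \sum_(s < t) p (rcons w s).

Lemma left_end_rcons w t : left_end (rcons w t) = cut w t.
Proof.
rewrite /left_end size_rcons big_ord_recr /= nth_rcons ltnn eqxx; congr (_ + _).
  apply: eq_bigr => i _; rewrite nth_rcons ltn_ord -(cats1 w t) takel_cat//.
  exact/ltnW.
by apply: eq_bigr => s _; rewrite -(cats1 w t) take_size_cat.
Qed.

Lemma cutS w t : cut w t.+1 = cut w t + p (rcons w t).
Proof. by rewrite /cut big_ord_recr addrA. Qed.

Lemma cut_le w s t : (s <= t)%N -> cut w s <= cut w t.
Proof.
move=> /subnK <-; elim: (t - s)%N => // n IH.
by rewrite addSn cutS (le_trans IH)// lerDl.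
Qed.

Lemma cut0 w : cut w 0 = left_end w.
Proof. by rewrite /cut big_ord0 addr0. Qed.

Lemma cutD w : cut w D = left_end w + p w.
Proof. by rewrite /cut [in RHS]p_rcons. Qed.

Definition cell w : set R := `[left_end w, left_end w + p w[%classic.

Lemma cell_rcons w t x : cell (rcons w t) x <-> cut w t <= x < cut w t.+1.
Proof. by rewrite /cell /= in_itv /= left_end_rcons -cutS. Qed.

Lemma alphabet_gt0 : (0 < D)%N.
Proof.
by case: (posnP D) p_rcons => // -> /(_ [::]); rewrite big_ord0 p_nil => /eqP; rewrite oner_eq0.
Qed.

(** The search stops before the last letter, so that a failure returns [D.-1]: the value is a letter
    even when [x] is outside [cell w]. *)
Definition next w (x : R) : nat := find (fun t => x < cut w t.+1) (iota 0 D.-1).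

Lemma next_lt w x : (next w x < D)%N.
Proof.
have := find_size (fun t => x < cut w t.+1) (iota 0 D.-1).
by rewrite size_iota /next; have := alphabet_gt0; lia.
Qed.

Lemma next_cell w x : cell w x -> cell (rcons w (next w x)) x.
Proof.
move=> xc; apply/cell_rcons; move: xc; rewrite /cell /= in_itv /= -cutD -cut0 => /andP[x0 xD].
set q := (fun t => x < cut w t.+1); set s := iota 0 D.-1.
have D0 := alphabet_gt0; apply/andP; split.
  case E : (next w x) => [//|m]; rewrite leNgt; apply/negP => xm.
  have mlt : (m < find q s)%N by rewrite -/(next w x) E.
  have := before_find 0%N mlt; rewrite nth_iota ?add0n /q ?xm//.
  by apply: leq_trans mlt _; rewrite -[leqRHS](size_iota 0) find_size.
have [hq|hq] := boolP (has q s).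
  have := nth_find 0%N hq; rewrite nth_iota ?add0n//.
  by rewrite -[ltnRHS](size_iota 0) -has_find.
by rewrite /next hasNfind// size_iota prednK.
Qed.

Lemma cell_sub w t x : (t < D)%N -> cell (rcons w t) x -> cell w x.
Proof.
move=> tD /cell_rcons/andP[x1 x2]; rewrite /cell /= in_itv /= -cutD -cut0.
by rewrite (le_trans (cut_le w (leq0n t)) x1) (lt_le_trans x2 (cut_le w tD)).
Qed.

Lemma cell_inj w s t x : cell (rcons w s) x -> cell (rcons w t) x -> s = t.
Proof.
move=> /cell_rcons/andP[s1 s2] /cell_rcons/andP[t1 t2]; case: (ltngtP s t) => // st.
  by have := lt_le_trans s2 (le_trans (cut_le w st) t1); rewrite ltxx.
by have := lt_le_trans t2 (le_trans (cut_le w st) s1); rewrite ltxx.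
Qed.

Fixpoint word n x := if n is n'.+1 then rcons (word n' x) (next (word n' x) x) else [::].

Lemma size_word n x : size (word n x) = n.
Proof. by elim: n => //= n IH; rewrite size_rcons IH. Qed.

Lemma cell_nil : cell [::] = `[0, 1[%classic.
Proof. by rewrite /cell /left_end big_ord0 add0r p_nil. Qed.

Lemma wordP w x : 0 <= x < 1 -> all (fun t => (t < D)%N) w ->
  word (size w) x = w <-> cell w x.
Proof.
move=> x01; elim/last_ind: w => [|w t IH].
  by rewrite cell_nil /= in_itv /= x01.
rewrite all_rcons size_rcons => /andP[tD /IH {}IH] /=; split.
  by move=> /rcons_inj[/[dup] wx /IH]; rewrite wx => + <-; apply: next_cell.
move=> xc; have xw := cell_sub tD xc; have -> := IH.2 xw.
by rewrite (cell_inj (next_cell xw) xc).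
Qed.

Lemma all_word n x : all (fun t => (t < D)%N) (word n x).
Proof. by elim: n => //= n IH; rewrite all_rcons next_lt. Qed.

Lemma cell_sub01 w : all (fun t => (t < D)%N) w -> (cell w `<=` `[0, 1[)%classic.
Proof.
elim/last_ind: w => [_|w t IH]; first by rewrite cell_nil.
by rewrite all_rcons => /andP[tD /IH wS] x /(cell_sub tD)/wS.
Qed.

(** The points outside [[0, 1[] have no mass; sending them all to 0 makes the words constant there,
    which keeps their level sets measurable. *)
Definition clamp (x : R) := if 0 <= x < 1 then x else 0.

Definition letter (x : R) i := nth 0%N (word i.+1 (clamp x)) i.

Lemma nth_word n i x : (i < n)%N -> nth 0%N (word n x) i = nth 0%N (word i.+1 x) i.
Proof.
elim: n => // n IH; rewrite ltnS leq_eqVlt => /orP[/eqP->//|ilt].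
by rewrite -(IH ilt) /= nth_rcons size_word ilt.
Qed.

Lemma letter_lt x i : (letter x i < D)%N.
Proof.
by have /all_nthP := all_word i.+1 (clamp x); apply; rewrite size_word.
Qed.

Lemma letters_word w x :
  (forall i, (i < size w)%N -> letter x i = nth 0%N w i) <-> word (size w) (clamp x) = w.
Proof.
split=> [lw|wE i iw]; last by rewrite /letter -(nth_word (n := size w))// wE.
apply: (@eq_from_nth _ 0%N); rewrite size_word// => i iw.
by rewrite nth_word// -lw.
Qed.

Lemma measurable_word w : measurable [set x : measurableTypeR R | word (size w) (clamp x) = w].
Proof.
have [wD|wD] := boolP (all (fun t => (t < D)%N) w); last first.
  rewrite [X in measurable X](_ : _ = set0)//; apply/seteqP; split=> // x /= wx.
  by rewrite -wx all_word in wD.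
pose C : set R := if `[< word (size w) 0 = w >] then ~` `[0, 1[%classic else set0.
rewrite [X in measurable X](_ : _ = (cell w `|` C)%classic).
  apply: measurableU; first exact: measurable_itv.
  by rewrite /C; case: ifP => // _; apply: measurableC; exact: measurable_itv.
apply/seteqP; split=> x /=.
  move=> wx; have [x01|x01] := boolP (0 <= x < 1).
    by left; apply/wordP => //; move: wx; rewrite /clamp x01.
  right; move: wx; rewrite /C /clamp (negbTE x01) => ?; rewrite asboolT//=.
  by rewrite in_itv /=; exact/negP.
case=> [xc|].
  have x01 : 0 <= x < 1 by have := cell_sub01 wD xc; rewrite /= in_itv.
  by rewrite /clamp x01; apply/wordP.
rewrite /C; case: asboolP => //= w0; rewrite in_itv /= => /negP/negbTE x01.
by rewrite /clamp x01.
Qed.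

Lemma letters_prob w : all (fun t => (t < D)%N) w ->
  @unit_prob R [set x | forall i, (i < size w)%N -> letter x i = nth 0%N w i] = (p w)%:E.
Proof.
move=> wD; have E : left_end w + p w - left_end w = p w by rewrite addrC addKr.
rewrite -[in RHS]E -unit_prob_itv ?lerDl//.
- rewrite /unit_prob /mrestr; congr lebesgue_measure; apply/seteqP; split=> x /=.
    move=> [/letters_word wx]; rewrite in_itv /= => x01; split=> //.
    by apply/wordP => //; move: wx; rewrite /clamp x01.
  move=> [xc]; rewrite in_itv /= => x01; split=> //; apply/letters_word.
  by rewrite /clamp x01; apply/wordP.
- by rewrite /left_end; do 2!(apply: sumr_ge0 => ? _).
- elim/last_ind: w wD {E} => [_|w t IH].
    by rewrite /left_end big_ord0 add0r p_nil.
  rewrite all_rcons left_end_rcons -cutS => /andP[tD /IH]; apply: le_trans.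
  by rewrite -cutD cut_le.
Qed.

Lemma measurable_letter i t : measurable [set x : measurableTypeR R | letter x i = t].
Proof.
rewrite [X in measurable X](_ : _ =
  \bigcup_(w : seq nat) (if (size w == i.+1) && (nth 0%N w i == t) then
     [set x : measurableTypeR R | word (size w) (clamp x) = w] else set0)).
  apply: countable_bigcupT_measurable => // w; case: ifP => // _.
  exact: measurable_word.
apply/seteqP; split=> x /= => [xt|[w _]].
  exists (word i.+1 (clamp x)) => //; rewrite size_word eqxx.
  by rewrite -/(letter x i) xt eqxx.
by case: ifP => //= /andP[/eqP wi /eqP wt] wx; rewrite /letter -wi wx.
Qed.

End RandomSequence.

(** * The sandpile measure *)

Lemma measure_disjoint_seq d (T : measurableType d) (R : realType)
    (mu : ({measure set T -> \bar R})%R) (I : eqType) (s : seq I) (A : I -> set T) :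
  (forall i, measurable (A i)) -> uniq s ->
  (forall x i j, i \in s -> j \in s -> A i x -> A j x -> i = j) ->
  (mu [set x | exists2 i, i \in s & A i x] = \sum_(i <- s) mu (A i))%E.
Proof.
move=> mA; elim: s => [_ _|i s IH /= /andP[si us] dis].
  rewrite (_ : [set x | _] = set0); last by apply/seteqP; split=> // x [].
  by rewrite measure0 big_nil.
have mB : measurable [set x | exists2 i, i \in s & A i x].
  by have [|//] := @le_measure_seq _ _ _ mu _ s A; move=> *; exact: mA.
rewrite (_ : [set x | exists2 j, j \in i :: s & A j x] =
  (A i `|` [set x | exists2 i, i \in s & A i x])%classic); last first.
  apply/seteqP; split=> x.
    by move=> [j]; rewrite in_cons => /orP[/eqP->|js] Aj; [left|right; exists j].
  by move=> [Ai|[j js Aj]]; [exists i; rewrite ?mem_head|exists j; rewrite ?in_cons ?js ?orbT].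
rewrite measureU//; last first.
  apply/seteqP; split=> // x [Ai [j js Aj]].
  by move: si; rewrite (dis x i j) ?js ?mem_head ?in_cons ?js ?orbT.
rewrite big_cons; congr (_ + _)%E; apply: IH => // x j k js ks.
by apply: dis; rewrite in_cons ?js ?ks orbT.
Qed.

Fixpoint words D n : seq (seq nat) :=
  if n is n'.+1 then [seq rcons w t | w <- words D n', t <- iota 0 D] else [:: [::]].

Lemma words_uniq D n : uniq (words D n).
Proof.
elim: n => //= n IH; apply: allpairs_uniq => //; first exact: iota_uniq.
by move=> [w t] [w' t'] _ _ /= /rcons_inj[-> ->].
Qed.

Lemma mem_words D n w : (w \in words D n) = (size w == n) && all (fun t => t < D) w.
Proof.
elim: n w => [|n IH] w; first by case: w.
apply/allpairsP/idP => [[[v t] /= [+ + ->]]|].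
  rewrite IH mem_iota add0n /= => /andP[/eqP <- vD] tD.
  by rewrite size_rcons eqxx all_rcons tD.
case: (lastP w) => [//|v t]; rewrite size_rcons eqSS all_rcons => /andP[vn /andP[tD vD]].
by exists (v, t); rewrite IH mem_iota vn vD.
Qed.

(** * The random height field and its finite-dimensional marginals *)

Section Marginals.
Variables (R : realType) (V : choiceType) (adj : rel V).
Hypothesis adj_simple : simple_graph adj.
Hypothesis adj_lf : locally_finite adj.
Hypothesis adj_conn : connected_graph adj.
Hypothesis V_inf : infinite_graph V.
Implicit Types (U W : {fset V}) (eta : V -> nat).

Lemma enumeration : exists (e : nat -> V) (idx : V -> nat), cancel e idx /\ cancel idx e.
Proof.
have [Vn [_ Vcov]] := exhaustion_ex adj_lf adj_conn V_inf.
have cV : countable [set: V].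
  rewrite (_ : [set: V] = \bigcup_n [set` Vn n])%classic.
    by apply: bigcup_countable => // n _; apply: finite_set_countable.
  by apply/seteqP; split=> // v _; have [n vn] := Vcov v; exists n.
have /card_set_bijP[f [_ f_inj f_surj]] := eq_card_nat cV V_inf.
have /choice[e eP] : forall n, exists v, f v = n.
  by move=> n; have [v _ <-] := f_surj n Logic.I; exists v.
exists e, f; split=> // v; apply: f_inj; rewrite ?inE//.
Qed.

Variables (e : nat -> V) (idx : V -> nat).
Hypothesis idxK : cancel e idx.
Hypothesis eK : cancel idx e.
Variable D : nat.
Hypothesis degD : forall x, deg adj x <= D.

Definition word_conf (w : seq nat) (v : V) := nth 0 w (idx v).
Definition word_dom (w : seq nat) : {fset V} := [fset e i | i in iota 0 (size w)].

Lemma agrees_word w eta :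
  agrees (word_dom w) (word_conf w) eta <-> forall i, i < size w -> eta (e i) = nth 0 w i.
Proof.
split=> [H i iw|H x /imfsetP[i /=]].
  rewrite H ?/word_conf ?idxK//; apply/imfsetP; exists i => //=.
  by rewrite mem_iota.
by rewrite mem_iota add0n => /= iw ->; rewrite H// /word_conf idxK.
Qed.

(** Recurrent configurations have heights below [D] on [U] and vanish off [U], so [S] has to cover
    only these; words of equal length give disjoint cylinders. *)
Lemma sandpile_words U (A : {fset V}) (a : V -> nat) n (S : seq (seq nat)) :
  uniq S -> {in S, forall w, size w = n} ->
  (forall w eta, w \in S -> agrees (word_dom w) (word_conf w) eta -> agrees A a eta) ->
  (forall eta, (forall x, x \in U -> eta x < D) -> (forall x, x \notin U -> eta x = 0) ->
     agrees A a eta -> exists2 w, w \in S & agrees (word_dom w) (word_conf w) eta) ->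
  sandpile_cyl R adj U A a =
  (\sum_(w <- S) sandpile_cyl R adj U (word_dom w) (word_conf w))%R.
Proof.
move=> uS Sn Ssub Scov; have [v vU] := outside V_inf U.
have cylE B b : sandpile_cyl R adj U B b =
    ((count_set (confs U (nbr adj) (fun=> 0) `&` agrees B b)%classic)%:R /
     (#|recurrent_set adj U|)%:R)%R.
  by rewrite /sandpile_cyl (count_sandpile adj_simple adj_lf adj_conn vU (agrees B b)).
rewrite cylE; under eq_bigr do rewrite cylE.
rewrite -big_distrl -natr_sum /=; congr (_%:R / _)%R.
have fc := finite_confs U (nbr adj) (fun=> 0).
transitivity (count_set ((confs U (nbr adj) (fun=> 0) `&` agrees A a) `&`
  [set eta | exists2 w, w \in S & agrees (word_dom w) (word_conf w) eta])%classic).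
  congr count_set; apply/seteqP; split=> [eta [ce ae]|eta [[]]//].
  split=> //; apply: Scov => //; have [e0 elt _] := ce => // x xU.
  exact: leq_trans (elt x xU) (degD x).
rewrite (count_disjoint (N := fun w => agrees (word_dom w) (word_conf w)))//.
- apply: eq_big_seq => w wS; congr count_set; apply/seteqP; split=> eta.
    by move=> [[]].
  by move=> [ce we]; split=> //; split=> //; apply: Ssub we.
- by apply: sub_finite_set fc => f [].
move=> eta w w' _ wS wS' /agrees_word we /agrees_word we'.
apply: (@eq_from_nth _ 0); rewrite ?Sn// => i iw.
by rewrite -we ?Sn// we' ?Sn.
Qed.

Variable L : {fset V} -> (V -> nat) -> R.
Hypothesis L_cvg : forall A a Vn, is_exhaustion Vn ->
  (fun n => sandpile_cyl R adj (Vn n) A a) @ \oo --> L A a.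
Hypothesis recurrent_gt0 : forall Vn, is_exhaustion Vn ->
  \forall n \near \oo, 0 < #|recurrent_set adj (Vn n)|.

Lemma limit_words (A : {fset V}) (a : V -> nat) n (S : seq (seq nat)) :
  uniq S -> {in S, forall w, size w = n} ->
  (forall w eta, w \in S -> agrees (word_dom w) (word_conf w) eta -> agrees A a eta) ->
  (forall eta, (forall x, eta x < D) ->
     agrees A a eta -> exists2 w, w \in S & agrees (word_dom w) (word_conf w) eta) ->
  0 < D -> L A a = (\sum_(w <- S) L (word_dom w) (word_conf w))%R.
Proof.
move=> uS Sn Ssub Scov D0; have [Vn ex] := exhaustion_ex adj_lf adj_conn V_inf.
have h1 := L_cvg (A := A) (a := a) ex.
have h2 : (fun n => sandpile_cyl R adj (Vn n) A a) @ \oo -->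
    (\sum_(w <- S) L (word_dom w) (word_conf w))%R.
  rewrite (_ : (fun n => _) = (fun n => \sum_(w <- S)
      sandpile_cyl R adj (Vn n) (word_dom w) (word_conf w))%R).
    by apply: cvg_big => [|w _]; [exact: add_continuous|exact: L_cvg].
  apply/funext => m; apply: (sandpile_words uS Sn Ssub) => eta elt e0.
  apply: Scov => x; have [/elt//|/e0->//] := boolP (x \in Vn m).
exact: (cvg_unique _ h1 h2).
Qed.

Definition word_prob w := L (word_dom w) (word_conf w).

Lemma word_prob_ge0 w : (0 <= word_prob w)%R.
Proof.
have [Vn ex] := exhaustion_ex adj_lf adj_conn V_inf.
apply: (cvgr_to_ge (L_cvg (A := word_dom w) (a := word_conf w) ex)).
by apply: nearW => n; rewrite divr_ge0.
Qed.

Lemma word_prob_nil : word_prob [::] = 1%R.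
Proof.
have [Vn ex] := exhaustion_ex adj_lf adj_conn V_inf.
have h1 := L_cvg (A := word_dom [::]) (a := word_conf [::]) ex.
have h2 : (fun n => sandpile_cyl R adj (Vn n) (word_dom [::]) (word_conf [::])) @ \oo -->
    (1%R : R).
  apply: cvg_near_cst; apply: filterS (recurrent_gt0 ex) => n n0; rewrite /sandpile_cyl.
  rewrite (_ : [set c in _ | _]%SET = recurrent_set adj (Vn n)).
    by rewrite divff// pnatr_eq0 -lt0n.
  apply/setP => c; rewrite [LHS]inE asboolT ?andbT// => x /imfsetP[i /=].
  by rewrite in_nil.
exact: (cvg_unique _ h1 h2).
Qed.

Lemma alphabet_nonempty : 0 < D.
Proof.
have [v0 _] := outside V_inf fset0; apply: leq_trans (degD v0).
have [v vU] := outside V_inf [fset v0].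
by apply: (deg_gt0 adj_lf adj_conn vU); rewrite inE.
Qed.

Lemma word_prob_rcons w : word_prob w = (\sum_(t < D) word_prob (rcons w t))%R.
Proof.
rewrite /word_prob (@limit_words _ _ (size w).+1 [seq rcons w t | t <- iota 0 D]).
- by rewrite big_map -[D in iota 0 D]subn0 big_mkord.
- by rewrite map_inj_uniq ?iota_uniq// => s t /rcons_inj[].
- by move=> _ /mapP[t _ ->]; rewrite size_rcons.
- move=> _ eta /mapP[t _ ->] /agrees_word we; apply/agrees_word => i iw.
  by rewrite we ?nth_rcons ?iw// size_rcons ltnW.
- move=> eta eD /agrees_word we; exists (rcons w (eta (e (size w)))).
    by apply: map_f; rewrite mem_iota eD.
  apply/agrees_word => i; rewrite size_rcons ltnS leq_eqVlt nth_rcons.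
  by case: (ltngtP i (size w)) => //= [/we//|->].
exact: alphabet_nonempty.
Qed.

Definition field (x : measurableTypeR R) : SConf V :=
  fun v => letter D word_prob x (idx v).

Lemma measurable_field : measurable_fun setT field.
Proof.
apply: (@measurability _ _ (measurableTypeR R) (SConf V) setT field (@cyl_sets V nat)).
  reflexivity.
move=> _ [_ [v [t ->]] <-]; rewrite setTI.
exact: (measurable_letter word_prob_ge0 word_prob_nil word_prob_rcons).
Qed.

(** The cylinder over [A] is a disjoint union of cylinders of words long enough to read all of [A].
    The field gives each of them its [word_prob], and [limit_words] recombines these into
    [L A a]. *)
Lemma field_prob (A : {fset V}) (a : V -> nat) :
  @unit_prob R (field @^-1` agrees A a)%classic = (L A a)%:E.
Proof.
have D0 := alphabet_nonempty.
pose n := (\max_(x <- A) idx x).+1.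
have idx_lt x : x \in A -> idx x < n by move=> xA; rewrite ltnS; apply: leq_bigmax_seq.
pose S := [seq w <- words D n | all (fun x => nth 0 w (idx x) == a x) A].
have SP w : (w \in S) = [&& all (fun x => nth 0 w (idx x) == a x) A, size w == n &
    all (fun t => t < D) w] by rewrite mem_filter mem_words.
have uS : uniq S by rewrite filter_uniq// words_uniq.
have Sn : {in S, forall w, size w = n} by move=> w; rewrite SP => /and3P[_ /eqP].
have Ssub w eta : w \in S -> agrees (word_dom w) (word_conf w) eta -> agrees A a eta.
  move=> wS /agrees_word we x xA; have := wS; rewrite SP => /and3P[/allP/(_ x xA)/eqP<- /eqP wn _].
  by rewrite -we ?eK// wn idx_lt.
have Scov eta : (forall x, eta x < D) -> agrees A a eta ->
    exists2 w, w \in S & agrees (word_dom w) (word_conf w) eta.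
  move=> eD ea; exists (mkseq (fun i => eta (e i)) n).
    rewrite SP size_mkseq eqxx andTb; apply/andP; split; apply/allP.
      by move=> x xA; rewrite nth_mkseq ?idx_lt// eK ea.
    by move=> _ /mapP[i _ ->].
  by apply/agrees_word => i; rewrite size_mkseq => ilt; rewrite nth_mkseq.
rewrite (limit_words uS Sn Ssub Scov D0) -sumEFin.
pose B w := [set x : measurableTypeR R | forall i, i < size w -> letter D word_prob x i = nth 0 w i].
have BP w x : B w x <-> agrees (word_dom w) (word_conf w) (field x).
  by split=> [Bx|/agrees_word we i iw]; [apply/agrees_word => i iw|]; rewrite -?Bx -?we// /field idxK.
have -> : (field @^-1` agrees A a)%classic = [set x | exists2 w, w \in S & B w x].
  apply/seteqP; split=> x; last by move=> [w wS /BP]; apply: Ssub.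
  move=> /(Scov (field x))[|w wS we]; last by exists w => //; apply/BP.
  by move=> v; apply: (letter_lt word_prob_nil word_prob_rcons).
rewrite measure_disjoint_seq//.
- apply: eq_big_seq => w; rewrite SP => /and3P[_ _ wD].
  exact: (letters_prob word_prob_ge0 word_prob_nil word_prob_rcons).
- move=> w; rewrite (_ : B w = [set x | word D word_prob (size w) (clamp x) = w]).
    exact: (measurable_word word_prob_ge0 word_prob_nil word_prob_rcons).
  by apply/seteqP; split=> x /letters_word.
move=> x w w' wS wS' wx wx'; apply: (@eq_from_nth _ 0); rewrite ?Sn// => i iw.
by rewrite -wx ?Sn// wx' ?Sn.
Qed.

End Marginals.

Lemma transitive_degree (V : choiceType) (adj : rel V) : locally_finite adj ->
  vertex_transitive adj -> forall x y, deg adj y <= deg adj x.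
Proof.
move=> lf vt x y; have [f [[f' fK f'K] [fadj <-]]] := vt x y.
rewrite /deg (_ : nbr adj (f x) = [fset f z | z in nbr adj x]).
  exact: leq_imfset_card.
apply/fsetP => z; rewrite in_nbr//; apply/idP/imfsetP => [fz|[u /=]].
  by exists (f' z); rewrite /= ?f'K// in_nbr// -fadj f'K.
by rewrite in_nbr// => xu ->; rewrite fadj.
Qed.

Local Open Scope classical_set_scope.
Local Open Scope ring_scope.

Theorem theorem7p2 (R : realType) (V : choiceType) (adj : rel V) :
  simple_graph adj -> locally_finite adj -> connected_graph adj ->
  infinite_graph V ->
  vertex_transitive adj ->                         (* (i)   *)
  srw_finitely_many_intersections R adj ->         (* (ii)  *)
  wsf_one_ended R adj ->                           (* (iii) *)
  bounded_harmonic_constant R adj ->               (* (iv)  *)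
  exists nu : probability (SConf V) R,
    nu [set eta : SConf V | forall x, (eta x < deg adj x)%N] = 1%E /\
    forall Vn : nat -> {fset V}, is_exhaustion Vn ->
    forall (A : {fset V}) (a : V -> nat),
      (fun n => (sandpile_cyl R adj (Vn n) A a)%:E) @ \oo -->
        nu [set eta : SConf V | forall x, x \in A -> eta x = a x].
Proof.
move=> simp lf conn inf vt _ [mu [mu_wsf mu_end]] _.
have lim A a := sandpile_limit simp lf conn inf mu_wsf mu_end A a.
have /choice[L0 L0P] : forall Aa : {fset V} * (V -> nat), exists l : R,
    forall Vn, is_exhaustion Vn ->
    (fun n => sandpile_cyl R adj (Vn n) Aa.1 Aa.2) @ \oo --> l.
  by move=> [A a]; exact: lim.
pose L A a := L0 (A, a).
have L_cvg A a Vn : is_exhaustion Vn ->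
    (fun n => sandpile_cyl R adj (Vn n) A a) @ \oo --> L A a.
  exact: (L0P (A, a)).
have rec_gt0 Vn : is_exhaustion Vn ->
    \forall n \near \oo, (0 < #|recurrent_set adj (Vn n)|)%N.
  move=> ex; apply: filterS (n_trees_gt0 simp lf mu_wsf ex) => n.
  by have [v vU] := outside inf (Vn n); rewrite (card_recurrent simp lf conn vU).
have [e [idx [idxK eK]]] := enumeration lf conn inf.
have [v0 _] := outside inf fset0.
pose D := deg adj v0.
have degD x : (deg adj x <= D)%N by exact: transitive_degree.
have mf := measurable_field simp lf conn inf idxK degD L_cvg rec_gt0.
pose nu : probability (SConf V) R := distribution (@unit_prob R) (mfun_Sub (mem_set mf)).
exists nu; split.
  (* All degrees equal the size of the alphabet, so the field is stable at every point and not just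
     almost surely. *)
  have degE x : deg adj x = D by apply/eqP; rewrite eqn_leq degD transitive_degree.
  rewrite -(@probability_setT _ _ _ (@unit_prob R)).
  congr unit_prob; apply/seteqP; split=> // x _ v /=; rewrite degE.
  apply: letter_lt.
  - exact: (word_prob_nil lf conn inf _ _ L_cvg rec_gt0).
  - exact: (word_prob_rcons simp lf conn inf idxK degD L_cvg).
move=> Vn ex A a.
rewrite [X in _ --> X](_ : _ = (L A a)%:E).
  by apply: cvg_EFin; [exact: nearW|exact: L_cvg].
exact: (field_prob simp lf conn inf idxK eK degD L_cvg rec_gt0).
Qed.
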